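(* Let $\mathcal{K}$ be a separable complex Hilbert space with an orthonormal basis $\{f_k\}_{k=0}^\infty$. Let $N\geq 2$. For each $1\leq l\leq N$, let $T_l$ be the bilateral forward operator weighted shift on $\ell^2(\mathbb{Z},\mathcal{K})$ with weight sequence $\{A^{(l)}_n\}_{n=-\infty}^\infty$, where $\{A_n^{(l)}\}_{n=-\infty}^\infty$ is a uniformly bounded sequence of positive invertible diagonal operators on $\mathcal{K}$. Then for any integers $1\leq r_1<r_2<\cdots<r_N$ the following statements are equivalent: (1) $T_1^{r_1},T_2^{r_2},\ldots,T_N^{r_N}$ are densely d-supercyclic. (2) There exists an increasing sequence $(n_k)_{k\geq 1}$ of positive integers such that: for every $i_1,i_2\in\mathbb{N}$, $j_1,j_2\in\mathbb{Z}$ and $1\leq l,s\leq N$, $$\lim_{k\to\infty}\left\|\left(\prod_{v=j_1-r_ln_k}^{j_1-1}(A_v^{(l)})^{-1}\right)f_{i_1}\right\|\left\|\left(\prod_{v=j_2}^{j_2+r_sn_k-1}A_v^{(s)}\right)f_{i_2}\right\|=0;$$ and for every $i\in\mathbb{N}$, $j\in\mathbb{Z}$ and $1\leq s<l\leq N$, $$\lim_{k\to\infty}\left\|\left(\prod_{v=j-r_sn_k}^{j-1}(A_v^{(s)})^{-1}\right)\left(\prod_{v=j-r_sn_k}^{j+(r_l-r_s)n_k-1}A_v^{(l)}\right)f_i\right\|=0,$$ $$\lim_{k\to\infty}\left\|\left(\prod_{v=j-r_ln_k}^{j-1}(A_v^{(l)})^{-1}\right)\left(\prod_{v=j-r_l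n_k}^{j-(r_l-r_s)n_k-1}A_v^{(s)}\right)f_i\right\|=0.$$
   Context: $\mathbb{N}=\{0,1,2,\ldots\}$; ''increasing'' for a sequence of integers means strictly increasing. $\ell^2(\mathbb{Z},\mathcal{K})=\{x=(x_i)_{i\in\mathbb{Z}}:x_i\in\mathcal{K},\ \sum_{i\in\mathbb{Z}}\|x_i\|^2<\infty\}$ with inner product $\langle x,y\rangle=\sum_{i\in\mathbb{Z}}\langle x_i,y_i\rangle_{\mathcal{K}}$. ''Diagonal'' means diagonal with respect to the orthonormal basis $\{f_k\}$: a positive invertible diagonal operator $A$ satisfies $Af_k=a_kf_k$ with $a_k>0$ for all $k$, with $A$ and $A^{-1}$ bounded. Uniformly bounded means $\sup_{n\in\mathbb{Z}}\|A_n\|<\infty$. The bilateral forward operator weighted shift $T$ on $\ell^2(\mathbb{Z},\mathcal{K})$ with weight sequence $\{A_n\}_{n\in\mathbb{Z}}$ is the bounded operator given by $(Tx)_j=A_{j-1}x_{j-1}$ for $j\in\mathbb{Z}$. d-supercyclicity: a continuous linear operator $T$ on a Banach space $X$ is supercyclic if $\{\lambda T^nx:n\in\mathbb{N},\lambda\in\mathbb{C}\}$ is dense in $X$ for some $x\in X$. For $N\geq 2$ and supercyclic operators $T_1,\ldots,T_N$ on $X$, a vector $x\in X$ is d-supercyclic if $\{\lambda(T_1^nx,\ldots,T_N^nx):n\in\mathbb{N},\lambda\in\mathbb{C}\}$ is dense in $X^N$. The operators are densely d-supercyclic if the set of their d-supercyclic vectors is dense in $X$. *)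

(* Defs.v *)
From HB Require Import structures.
From mathcomp Require Import all_boot all_order all_algebra.
From mathcomp Require Import complex.
From mathcomp Require Import all_classical all_reals all_analysis.
From mathcomp Require Import sesquilinear ring zify.

Set Implicit Arguments.
Unset Strict Implicit.
Unset Printing Implicit Defensive.

Import Order.TTheory GRing.Theory Num.Theory.
Import numFieldNormedType.Exports.

Local Open Scope classical_set_scope.
Local Open Scope ring_scope.
Local Open Scope complex_scope.

Section RealNorm.
Context {R : realType} {V : normedModType R[i]}.

(* The library norm of a space over [R[i]] takes values in [R[i]]; it is a
   nonnegative real there, so this is the same number read in [R]. *)
Definition rnorm (x : V) : R := complex.Re `|x|.

Lemma rnormE x : (rnorm x)%:C = `|x|.
Proof. by rewrite /rnorm RRe_real ?normr_real. Qed.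

Lemma rnorm_ge0 x : 0 <= rnorm x.
Proof. by rewrite -lecR rnormE normr_ge0. Qed.

Lemma rnorm0 : rnorm 0 = 0.
Proof. by rewrite /rnorm normr0. Qed.

Lemma rnorm0_eq0 x : rnorm x = 0 -> x = 0.
Proof. by move=> x0; apply/normr0_eq0; rewrite -rnormE x0. Qed.

Lemma ler_rnormD x y : rnorm (x + y) <= rnorm x + rnorm y.
Proof. by rewrite -lecR rmorphD /= !rnormE ler_normD. Qed.

Lemma rnormZ (a : R[i]) x : rnorm (a *: x) = complex.Re `|a| * rnorm x.
Proof.
by rewrite {1}/rnorm normrZ -[`|x|]rnormE /= mulr0 subr0.
Qed.

End RealNorm.

Section Ell2.
Context {R : realType} (K : normedModType R[i]).
Implicit Types x y : int -> K.

(* [\sum_(i : int) `|x i| ^ 2], possibly infinite. *)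
Definition sqsum x : \bar R :=
  (\esum_(i in [set: int]) (rnorm (x i) ^+ 2)%:E)%E.

Lemma sqsum_ge0 x : (0 <= sqsum x)%E.
Proof. by apply: esum_ge0 => i _; rewrite lee_fin sqr_ge0. Qed.

Lemma sqsumZ_le (c : R) (u : int -> R) : 0 <= c ->
  (\esum_(i in [set: int]) (c * u i ^+ 2)%:E <=
   c%:E * \esum_(i in [set: int]) (u i ^+ 2)%:E)%E.
Proof.
move=> c0; apply: ge_ereal_sup => _ [F [finF _] <-].
under eq_fsbigr do rewrite EFinM.
rewrite -ge0_mule_fsumr; last by move=> i; rewrite lee_fin sqr_ge0.
rewrite lee_wpmul2l ?lee_fin//.
by apply: ereal_sup_ubound; exists F.
Qed.

Lemma sqsumD_le x y (t : R) : 0 < t ->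
  (sqsum (x + y)%R <= (1 + t)%:E * sqsum x + (1 + t^-1)%:E * sqsum y)%E.
Proof.
move=> t0.
have t1 : 0 <= 1 + t by rewrite addr_ge0 ?ltW.
have t1V : 0 <= 1 + t^-1 by rewrite addr_ge0 ?invr_ge0 ?ltW.
apply: le_trans (leeD (sqsumZ_le (fun i => rnorm (x i)) t1)
                      (sqsumZ_le (fun i => rnorm (y i)) t1V)).
rewrite -esumD; [|by move=> i _; rewrite lee_fin mulr_ge0 ?sqr_ge0..].
apply: le_esum => i _; rewrite -EFinD lee_fin.
apply: (@le_trans _ _ ((rnorm (x i) + rnorm (y i)) ^+ 2)).
  by rewrite ler_sqr ?nnegrE ?addr_ge0 ?rnorm_ge0 ?ler_rnormD.
set a := rnorm _; set b := rnorm _.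
rewrite -subr_ge0.
have -> : (1 + t) * a ^+ 2 + (1 + t^-1) * b ^+ 2 - (a + b) ^+ 2 =
          t^-1 * (t * a - b) ^+ 2.
  by field; rewrite gt_eqF.
by rewrite mulr_ge0 ?sqr_ge0// invr_ge0 ltW.
Qed.

Lemma sqsumZ (a : R[i]) x : (sqsum x < +oo)%E ->
  sqsum (a *: x) = ((complex.Re `|a| ^+ 2)%:E * sqsum x)%E.
Proof.
have le b z : (sqsum (b *: z) <= (complex.Re `|b| ^+ 2)%:E * sqsum z)%E.
  rewrite /sqsum; apply: le_trans (sqsumZ_le _ (sqr_ge0 _)).
  by apply: le_esum => i _; rewrite lee_fin rnormZ exprMn.
move=> xoo; apply/eqP; rewrite eq_le le andTb.
have [->|a0] := eqVneq a 0.
  by rewrite normr0 expr0n mul0e sqsum_ge0.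
have na0 : 0 < complex.Re `|a| by rewrite -ltcR RRe_real ?normr_real// normr_gt0.
rewrite -lee_pdivlMl ?exprn_gt0//.
apply: le_trans (_ : (sqsum (a^-1 *: (a *: x)) <= _)%E).
  by rewrite scalerA mulVf// scale1r.
apply: le_trans (le _ _) _.
suff -> : complex.Re `|a^-1| ^+ 2 = (complex.Re `|a| ^+ 2)^-1 by [].
rewrite -exprVn normfV; congr (_ ^+ 2).
have -> : `|a| = (complex.Re `|a|)%:C by rewrite RRe_real ?normr_real.
by rewrite -fmorphV.
Qed.

Definition ell2_pred : {pred int -> K} := [pred x | (sqsum x < +oo)%E].

Lemma ell2_submod_closed : submod_closed ell2_pred.
Proof.
split.
  rewrite inE /sqsum esum1 ?ltry// => i _.
  by rewrite rnorm0 expr0n.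
move=> a x y; rewrite !inE => xoo yoo.
apply: le_lt_trans (sqsumD_le _ _ ltr01) _.
rewrite lte_add_pinfty// lte_mul_pinfty ?lee_fin ?addr_ge0 ?invr_ge0//.
by rewrite sqsumZ// lte_mul_pinfty ?lee_fin ?sqr_ge0.
Qed.

HB.instance Definition _ :=
  GRing.isSubmodClosed.Build R[i] (int -> K) ell2_pred ell2_submod_closed.

Record ell2 := Ell2 { ell2_val :> int -> K; _ : ell2_val \in ell2_pred }.

HB.instance Definition _ := [isSub for ell2_val].
HB.instance Definition _ := [Choice of ell2 by <:].
HB.instance Definition _ := [SubChoice_isSubLmodule of ell2 by <:].

(* The norm induced by the inner product
   [<x, y> = \sum_(i : int) <x i, y i>]. *)
Definition ell2_norm (x : ell2) : R[i] := (Num.sqrt (fine (sqsum x)))%:C.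

Lemma sqsum_fin (x : ell2) : sqsum x \is a fin_num.
Proof. by rewrite ge0_fin_numE ?sqsum_ge0//; case: x => x. Qed.

Lemma sqsum_fineK (x : ell2) : ((fine (sqsum x))%:E = sqsum x)%E.
Proof. by rewrite fineK ?sqsum_fin. Qed.

Lemma fine_sqsum_ge0 (x : ell2) : 0 <= fine (sqsum x).
Proof. by rewrite fine_ge0 ?sqsum_ge0. Qed.

Lemma ell2_normD (x y : ell2) : ell2_norm (x + y) <= ell2_norm x + ell2_norm y.
Proof.
rewrite /ell2_norm -rmorphD lecR; apply/ler_addgt0Pr => e e0.
set a := Num.sqrt (fine (sqsum x)); set b := Num.sqrt (fine (sqsum y)).
have a0 : 0 <= a by exact: sqrtr_ge0.
have b0 : 0 <= b by exact: sqrtr_ge0.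
have ae : 0 < a + e / 2 by rewrite ltr_wpDl ?divr_gt0.
have be : 0 < b + e / 2 by rewrite ltr_wpDl ?divr_gt0.
have sa : a ^+ 2 = fine (sqsum x) by rewrite sqr_sqrtr ?fine_sqsum_ge0.
have sb : b ^+ 2 = fine (sqsum y) by rewrite sqr_sqrtr ?fine_sqsum_ge0.
have abe : 0 <= a + b + e by rewrite !addr_ge0 // ltW.
rewrite -(ger0_norm abe) -sqrtr_sqr; apply: ler_wsqrtr.
pose t := (b + e / 2) / (a + e / 2).
have t0 : 0 < t by rewrite divr_gt0.
have := sqsumD_le x y t0.
rewrite -(sqsum_fineK (x + y)) -(sqsum_fineK x) -(sqsum_fineK y) -sa -sb.
rewrite -!EFinM -EFinD lee_fin => /le_trans; apply.
have -> : (a + b + e) ^+ 2 =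
  (1 + t) * (a + e / 2) ^+ 2 + (1 + t^-1) * (b + e / 2) ^+ 2.
  rewrite [a + b + e](_ : _ = (a + e / 2) + (b + e / 2)); last by field.
  rewrite /t; move: (a + e / 2) (b + e / 2) ae be => p q p0 q0.
  by field; rewrite !gt_eqF.
have aae : a ^+ 2 <= (a + e / 2) ^+ 2.
  by rewrite ler_sqr ?nnegrE ?(ltW ae)// lerDl ltW ?divr_gt0.
have bbe : b ^+ 2 <= (b + e / 2) ^+ 2.
  by rewrite ler_sqr ?nnegrE ?(ltW be)// lerDl ltW ?divr_gt0.
by rewrite lerD// ler_wpM2l// addr_ge0// ?invr_ge0 ltW.
Qed.

Lemma ell2_normZ (a : R[i]) (x : ell2) :
  ell2_norm (a *: x) = `|a| * ell2_norm x.
Proof.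
have xoo : (sqsum x < +oo)%E by rewrite -ge0_fin_numE ?sqsum_ge0 ?sqsum_fin.
have a0 : 0 <= complex.Re `|a| by rewrite -lecR RRe_real ?normr_real ?normr_ge0.
rewrite /ell2_norm [X in fine X](sqsumZ a xoo) -sqsum_fineK -EFinM /=.
rewrite sqrtrM ?sqr_ge0// sqrtr_sqr (ger0_norm a0) rmorphM.
by congr (_ * _); rewrite RRe_real ?normr_real.
Qed.

Lemma ell2_norm0_eq0 (x : ell2) : ell2_norm x = 0 -> x = 0.
Proof.
move=> /(@complexI R) /eqP; rewrite sqrtr_eq0 => s0.
have sx : (sqsum x <= 0)%E by rewrite -sqsum_fineK lee_fin.
apply/val_inj/funext => i /=; apply: rnorm0_eq0; apply/eqP.
rewrite -sqrf_eq0 eq_le sqr_ge0 andbT -lee_fin.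
apply: le_trans sx; apply: ereal_sup_ubound; exists [set i].
  by split.
by rewrite fsbig_set1.
Qed.

HB.instance Definition _ :=
  Lmodule_isNormed.Build R[i] ell2 ell2_normD ell2_normZ ell2_norm0_eq0.

Lemma rnorm_ell2 (x : ell2) : rnorm x = Num.sqrt (fine (sqsum x)).
Proof. by []. Qed.

End Ell2.

Section Hilbert.
Context {R : realType} {K : normedModType R[i]}.

Definition separable : Prop := exists2 D : set K, countable D & dense D.

Definition induces_norm (ip : {dot K for @Num.conj R[i]}) : Prop :=
  forall x : K, `|x| ^+ 2 = ip x x.

Definition orthonormal_basis (ip : {dot K for @Num.conj R[i]})
    (f : nat -> K) : Prop :=
  (forall i j : nat, ip (f i) (f j) = (i == j)%:R) /\
  (forall x : K, series (fun k => ip x (f k) *: f k) @ \oo --> x).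

End Hilbert.

Section Operators.
Context {R : realType} {K : normedModType R[i]}.

(* The two-sided inverse when [A] is bijective, and junk otherwise. *)
Definition opinv (A : K -> K) : K -> K := 'pinv_(fun=> 0) setT A.

(* For linear maps continuity is boundedness. *)
Definition pos_inv_diagonal (f : nat -> K) (A : {linear K -> K}) : Prop :=
  [/\ continuous A, bijective A, continuous (opinv A) &
      exists a : nat -> R, forall k, 0 < a k /\ A (f k) = (a k)%:C *: f k].

Definition uniformly_bounded (A : int -> {linear K -> K}) : Prop :=
  exists M : R, forall n x, rnorm (A n x) <= M * rnorm x.

(* The integers [v] with [a <= v <= b], in increasing order. *)
Definition int_range (a b : int) : seq int :=
  [seq a + m%:Z | m <- iota 0 (absz (Num.max 0 (b - a + 1)))].

(* [A a \o ... \o A b]; the order is immaterial for commuting operators, such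
   as diagonal ones. *)
Definition opprod (a b : int) (A : int -> K -> K) : K -> K :=
  \big[(fun g h => g \o h)/idfun]_(v <- int_range a b) A v.

Definition is_forward_shift (A : int -> {linear K -> K})
    (T : {linear ell2 K -> ell2 K}) : Prop :=
  continuous T /\
  forall (x : ell2 K) (j : int), T x j = A (j - 1) (x (j - 1)).

Lemma mem_int_range (a b v : int) : (v \in int_range a b) = (a <= v <= b).
Proof.
apply/mapP/andP => [[m]|[av vb]].
  rewrite mem_iota add0n /= => mlt ->; lia.
by exists (absz (v - a)); [rewrite mem_iota; lia|lia].
Qed.

Lemma opinvK (A : K -> K) : bijective A -> cancel A (opinv A).
Proof. by move=> bA x; rewrite /opinv pinvKV ?inE//; apply: in2W (bij_inj bA). Qed.

Lemma opinvKV (A : K -> K) : bijective A -> cancel (opinv A) A.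
Proof.
by case=> B AB BA x; rewrite /opinv pinvK// inE; exists (B x).
Qed.

Section ForwardShift.
Variables (A : int -> {linear K -> K}) (M : R).
Hypothesis AM : forall n x, rnorm (A n x) <= M * rnorm x.

Lemma sqsum_shift (x : int -> K) :
  (sqsum (fun j => A (j - 1) (x (j - 1)))%R <= (M ^+ 2)%:E * sqsum x)%E.
Proof.
apply: le_trans (sqsumZ_le (fun i => rnorm (x i)) (sqr_ge0 M)).
rewrite [leRHS](@reindex_esum _ _ _ setT setT (fun j : int => j - 1)); last first.
  split=> //= [i j _ _ /addIr//|i _]; exists (i + 1) => //; lia.
apply: le_esum => i _; rewrite lee_fin -exprMn ler_sqr ?nnegrE ?rnorm_ge0//.
exact: le_trans (rnorm_ge0 _) (AM _ _).
Qed.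

Lemma shift_subproof (x : ell2 K) :
  (fun j => A (j - 1) (x (j - 1))) \in @ell2_pred R K.
Proof.
rewrite inE; apply: le_lt_trans (sqsum_shift x) _.
by rewrite lte_mul_pinfty ?lee_fin ?sqr_ge0//; case: x.
Qed.

Let shift (x : ell2 K) := Ell2 (shift_subproof x).

Let shift_linear : linear shift.
Proof.
by move=> a x y; apply/val_inj/funext => j /=; rewrite linearP.
Qed.

HB.instance Definition _ :=
  GRing.isLinear.Build R[i] (ell2 K) (ell2 K) *:%R shift shift_linear.

Lemma is_forward_shift_ex : exists T, is_forward_shift A T.
Proof.
exists shift; split=> //; apply: bounded_linear_continuous.
apply/linear_boundedP; exists `|M|%:C; split; first by rewrite complex_real.
move=> r Mr x; apply: le_trans (ler_wpM2r (normr_ge0 _) (ltW Mr)).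
rewrite -rnormE -[`|x|]rnormE -rmorphM lecR !rnorm_ell2 -sqrtr_sqr.
rewrite -sqrtrM ?sqr_ge0// ler_wsqrtr// -lee_fin EFinM !sqsum_fineK.
exact: sqsum_shift.
Qed.

End ForwardShift.

Lemma forward_shift_exists (A : int -> {linear K -> K}) :
  uniformly_bounded A -> exists T, is_forward_shift A T.
Proof. by case=> M; exact: is_forward_shift_ex. Qed.

End Operators.

Section Supercyclicity.
Context {R : realType} {X : normedModType R[i]}.

(* These notions are meant for continuous linear [T]. *)
Definition supercyclic (T : X -> X) : Prop :=
  exists x : X,
    dense [set y : X | exists (n : nat) (c : R[i]), y = c *: iter n T x].

Definition d_supercyclic_vector (N : nat) (T : 'I_N -> X -> X) (x : X) : Prop :=
  dense [set y : prod_topology (fun _ : 'I_N => X) |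
    exists (n : nat) (c : R[i]), y = (fun l => c *: iter n (T l) x)].

Definition densely_d_supercyclic (N : nat) (T : 'I_N -> X -> X) : Prop :=
  (forall l, supercyclic (T l)) /\
  dense [set x : X | d_supercyclic_vector T x].

End Supercyclicity.

(* Main.v *)
Require Import Defs.
From HB Require Import structures.
From mathcomp Require Import all_boot all_order all_algebra.
From mathcomp Require Import complex.
From mathcomp Require Import all_classical all_reals all_analysis.
From mathcomp Require Import sesquilinear ring lra zify.

(** All operators act on the orthonormal basis of the vectors carrying [f i] at
    one position [j]: the [n]-th power of a shift sends such a vector to the one
    at position [j + n], multiplied by a product of [n] consecutive weights.
    Up to this translation ([rnorm_opprod], [rnorm_opprod_opinv],
    [rnorm_opprod_mixed]) the three limits say the following. First, a
    product of weights leading into a position from the far left dominates any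
    product leading away to the right. Second and third, which become one
    condition for all [s != l]: lifting a basis vector back along the shift [s]
    and pushing it forward along another shift [l] gives something small.

    Sufficiency. Given a vector [x] and targets [Y t], perturb all of them to
    finite combinations of basis vectors. Add to [x] the vector
    [c^-1 *: \sum_l s l], where [s l] lifts [Y l] along the power of shift [l].
    The power of shift [t] maps [s t] onto [Y t], and [s l], [l != t], to
    something small by the second condition. By the first one
    the norm of the lifts times the norm of the images of [x] is small, so a
    scalar [c] makes both [c^-1 *: s l] and [c] times these images small
    ([supercyclic_approximation]). Hence for each target and precision the
    admissible vectors form a dense open set, and Baire's theorem in the space
    of square-summable families ([ell2_complete], [ell2_baire]) gives a dense
    set of vectors admissible for all targets ([dense_common_orbits]).

    Necessity. Take a disjoint supercyclic vector [x] near the sum [y] of the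
    basis vectors in a finite window, and [n], [c] such that [c] times the images
    of [x] are all near the analogous sum for a slightly larger window. Reading
    off single coefficients, each product of weights links a coefficient of [x]
    with one of an image of [x]; when [n] is large compared with the window one
    of them is near [1] and the other near [0]. Multiplying or dividing two such
    relations eliminates [c] and yields the smallness of the products
    ([window_estimates], [exists_small_window]). Growing windows and shrinking
    precisions give the sequence ([exists_vanishing_sequence]). *)

Set Implicit Arguments.
Unset Strict Implicit.
Unset Printing Implicit Defensive.

Import Order.TTheory GRing.Theory Num.Theory.
Import numFieldNormedType.Exports.

Local Open Scope classical_set_scope.
Local Open Scope ring_scope.

(** * Norms as real numbers *)

Section RealNormTopology.
Context {R : realType}.
Implicit Types V W : normedModType R[i].

Lemma rnormN V (x : V) : rnorm (- x) = rnorm x.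
Proof. by rewrite /rnorm normrN. Qed.

Lemma rnorm_distC V (x y : V) : rnorm (x - y) = rnorm (y - x).
Proof. by rewrite -rnormN opprB. Qed.

Lemma rnorm_sum V (I : Type) (s : seq I) (P : pred I) (F : I -> V) :
  rnorm (\sum_(i <- s | P i) F i) <= \sum_(i <- s | P i) rnorm (F i).
Proof.
elim/big_rec2: _ => [|i a b _ IH]; first by rewrite rnorm0.
by apply: le_trans (ler_rnormD _ _) _; rewrite lerD2l.
Qed.

Lemma rnormZr V (c : R) (x : V) : 0 <= c -> rnorm (c%:C%C *: x) = c * rnorm x.
Proof. by move=> c0; rewrite rnormZ ger0_norm ?lecR. Qed.

Lemma complex_posP (e : R[i]) : 0 < e -> exists2 d : R, 0 < d & e = d%:C%C.
Proof. by case: e => a b; rewrite ltcE /= => /andP[/eqP -> a0]; exists a. Qed.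

Lemma nbhs_rnormP V (x : V) (A : set V) :
  nbhs x A <-> exists2 e : R, 0 < e & forall y, rnorm (y - x) < e -> A y.
Proof.
split.
  move=> /nbhs_ballP[e /= /complex_posP[d d0 ->] xA]; exists d => // y yx.
  by apply: xA; rewrite -ball_normE /= -rnormE ltcR rnorm_distC.
move=> [e e0 xA]; apply/nbhs_ballP; exists e%:C%C; first by rewrite /= ltcR.
by move=> y; rewrite -ball_normE /= -rnormE ltcR rnorm_distC => /xA.
Qed.

Lemma dense_rnormP V (A : set V) :
  dense A <-> forall x (e : R), 0 < e -> exists2 y, A y & rnorm (y - x) < e.
Proof.
split=> [dA x e e0|dA O [x Ox] oO].
  have xO : nbhs x [set y | rnorm (y - x) < e] by apply/nbhs_rnormP; exists e.
  have [||y [/interior_subset ye Ay]] := dA (interior [set y | rnorm (y - x) < e]).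
  - by exists x.
  - exact: open_interior.
  - by exists y.
have /nbhs_rnormP[e e0 xO] : nbhs x O by apply: open_nbhs_nbhs.
by have [y Ay /xO] := dA x e e0; exists y.
Qed.

Lemma cvg_rnormP V (u : nat -> V) (l : V) :
  u @ \oo --> l <-> forall e : R, 0 < e -> \forall n \near \oo, rnorm (u n - l) < e.
Proof.
split=> [ul e e0|ul A /nbhs_rnormP[e e0 lA]].
  by apply: (ul [set y | rnorm (y - l) < e]); apply/nbhs_rnormP; exists e.
by apply: filterS (ul e e0) => n /lA.
Qed.

Lemma continuous_rnormP V W (g : V -> W) : continuous g ->
  forall x (e : R), 0 < e ->
  exists2 d : R, 0 < d & forall y, rnorm (y - x) < d -> rnorm (g y - g x) < e.
Proof.
move=> cg x e e0; apply/nbhs_rnormP.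
by apply: (cg x [set z | rnorm (z - g x) < e]); apply/nbhs_rnormP; exists e.
Qed.

(** Convergence in a product is coordinatewise, so the filter generated by the
    boxes converges to its centre, hence refines the neighbourhood filter; and
    boxes are neighbourhoods because the index set is finite. *)
Lemma dense_prodP (X : normedModType R[i]) (N : nat)
    (A : set (prod_topology (fun _ : 'I_N => X))) :
  dense A <-> forall (Y : 'I_N -> X) (e : R), 0 < e ->
    exists2 z, A z & forall l, rnorm (z l - Y l) < e.
Proof.
pose box (Y : prod_topology (fun _ : 'I_N => X)) (e : R) :=
  [set z : prod_topology (fun _ : 'I_N => X) | forall l, rnorm (z l - Y l) < e].
have box_filter Y : Filter (filter_from [set e : R | 0 < e] (box Y)).
  apply: filter_from_filter; first by exists 1; rewrite /= ltr01.
  move=> a b /= a0 b0; exists (Num.min a b); first by rewrite /= lt_min a0.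
  by move=> z zb; split=> l; have := zb l; rewrite lt_min => /andP[].
split=> [dA Y e e0|dA O [Y OY] oO].
  have Ybox : nbhs (Y : {ptws 'I_N -> X}) (box Y e).
    apply: (@filter_forall _ _ (fun l z => rnorm (z l - Y l) < e) _
      (nbhs_filter (Y : {ptws 'I_N -> X}))) => l.
    apply: (@proj_continuous _ (fun _ : 'I_N => X) l Y [set w | rnorm (w - Y l) < e]).
    by apply/nbhs_rnormP; exists e.
  have [||z [/interior_subset ze Az]] := dA (interior (box Y e)).
  - by exists Y.
  - exact: open_interior.
  - by exists z.
have /(_ O) : filter_from [set e : R | 0 < e] (box Y) --> (Y : {ptws 'I_N -> X}).
  apply/cvg_sup => l; apply/cvg_image.
    by apply/seteqP; split=> // x _; exists (fun=> x).
  move=> B /nbhs_rnormP[e e0 YB].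
  exists [set z | B (z l)].
    by exists e => // z /(_ l) /YB.
  apply/seteqP; split=> [_ [z Bz <-]//|x Bx].
  by exists (fun=> x).
case; first exact: open_nbhs_nbhs.
by move=> e e0 YO; have [z Az /YO] := dA Y e e0; exists z.
Qed.

End RealNormTopology.

(** * The space of square-summable families *)

Section Ell2Geometry.
Context {R : realType} {K : normedModType R[i]}.
Implicit Types x y : ell2 K.

Lemma sqsum_leP (x : int -> K) (c : R) :
  (sqsum x <= c%:E)%E <->
  forall s : seq int, uniq s -> \sum_(i <- s) rnorm (x i) ^+ 2 <= c.
Proof.
split=> [xc s us|xc].
  rewrite -lee_fin -sumEFin; apply: le_trans xc; apply: esum_ge.
  by exists [set` s]; [split=> //; exact: finite_seq|rewrite fsbig_seq].
apply: ge_ereal_sup => _ [F [finF _] <-].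
by rewrite fsbig_finite//= sumEFin lee_fin xc ?finmap.fset_uniq.
Qed.

Lemma rnorm_ell2_leP x (c : R) : 0 <= c ->
  rnorm x <= c <->
  forall s : seq int, uniq s -> \sum_(i <- s) rnorm (x i) ^+ 2 <= c ^+ 2.
Proof.
move=> c0; rewrite -sqsum_leP -sqsum_fineK lee_fin rnorm_ell2.
by rewrite -{1}(ger0_norm c0) -sqrtr_sqr ler_sqrt ?sqr_ge0.
Qed.

Lemma rnorm_coord_le x (j : int) : rnorm (x j) <= rnorm x.
Proof.
have /rnorm_ell2_leP : rnorm x <= rnorm x by [].
move=> /(_ (rnorm_ge0 _) [:: j] isT); rewrite big_seq1.
by rewrite ler_sqr ?nnegrE ?rnorm_ge0.
Qed.

Lemma ell2D x y (j : int) : (x + y) j = x j + y j. Proof. by []. Qed.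
Lemma ell2B x y (j : int) : (x - y) j = x j - y j. Proof. by []. Qed.
Lemma ell2Z (a : R[i]) x (j : int) : (a *: x) j = a *: x j. Proof. by []. Qed.

Lemma ell2_sum (I : Type) (s : seq I) (F : I -> ell2 K) (j : int) :
  (\sum_(i <- s) F i) j = \sum_(i <- s) F i j.
Proof. by elim/big_rec2: _ => [//|i a b _ <-]. Qed.

Lemma eq_ell2 x y : (forall j, x j = y j) -> x = y.
Proof. by move=> xy; apply/val_inj/funext. Qed.

Definition single_fun (j : int) (y : K) (i : int) : K := if i == j then y else 0.

Lemma sum_single_fun (j : int) (y : K) (s : seq int) : uniq s ->
  \sum_(i <- s) rnorm (single_fun j y i) ^+ 2 <= rnorm y ^+ 2.
Proof.
move=> us; rewrite (eq_bigr (fun i => if i == j then rnorm y ^+ 2 else 0)).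
  rewrite -big_mkcond/=.
  have [js|js] := boolP (j \in s).
    by rewrite big_mkcond (bigD1_seq j)//= eqxx big1 ?addr0// => i /negbTE ->.
  rewrite big_seq_cond big_pred0 ?sqr_ge0// => i.
  by apply/andP => -[/[swap]/eqP->]; rewrite (negbTE js).
move=> i _; rewrite /single_fun; case: eqP => // _.
by rewrite rnorm0 expr0n.
Qed.

Lemma single_subproof (j : int) (y : K) : single_fun j y \in @ell2_pred R K.
Proof.
rewrite inE (@le_lt_trans _ _ (rnorm y ^+ 2)%:E) ?ltry//.
by apply/sqsum_leP => s; exact: sum_single_fun.
Qed.

Definition single (j : int) (y : K) : ell2 K := Ell2 (single_subproof j y).

Lemma singleE j (y : K) i : single j y i = if i == j then y else 0. Proof. by []. Qed.

Lemma rnorm_single j (y : K) : rnorm (single j y) = rnorm y.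
Proof.
apply/eqP; rewrite eq_le; apply/andP; split.
  by apply/rnorm_ell2_leP => [|s]; [exact: rnorm_ge0|exact: sum_single_fun].
by have := rnorm_coord_le (single j y) j; rewrite singleE eqxx.
Qed.

Lemma single_is_linear j : linear (single j).
Proof.
move=> a x y; apply: eq_ell2 => i; rewrite ell2D ell2Z !singleE.
by case: eqP => // _; rewrite scaler0 addr0.
Qed.

HB.instance Definition _ j :=
  GRing.isLinear.Build R[i] K (ell2 K) *:%R (single j) (single_is_linear j).

(** A finite set whose partial sum comes within [e ^+ 2] of the supremum leaves
    at most [e ^+ 2] for any finite set disjoint from it. *)
Lemma ell2_trunc x (e : R) : 0 < e ->
  exists2 s : seq int, uniq s & rnorm (x - \sum_(j <- s) single j (x j)) <= e.
Proof.
move=> e0.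
have [s us xs] : exists2 s : seq int, uniq s &
    fine (sqsum x) - e ^+ 2 < \sum_(j <- s) rnorm (x j) ^+ 2.
  apply: contrapT => nx.
  have : (sqsum x <= (fine (sqsum x) - e ^+ 2)%:E)%E.
    apply/sqsum_leP => s us; rewrite leNgt; apply/negP => xs; apply: nx.
    by exists s.
  by rewrite -{1}sqsum_fineK lee_fin lerBrDr gerDl leNgt exprn_gt0.
exists s => //; apply/rnorm_ell2_leP; first exact: ltW.
move=> t ut.
have coordE i : (x - \sum_(j <- s) single j (x j)) i = if i \in s then 0 else x i.
  rewrite ell2B ell2_sum.
  under eq_bigr do rewrite singleE.
  have [si|si] := boolP (i \in s).
    rewrite (bigD1_seq i)//= eqxx big1 ?addr0 ?subrr// => j.
    by rewrite eq_sym => /negbTE ->.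
  rewrite big_seq big1 ?subr0// => j js.
  by case: eqP => // ij; rewrite ij js in si.
under eq_bigr do rewrite coordE.
rewrite (bigID (mem s))/= [X in X + _]big1 => [|i ->]; last by rewrite rnorm0 expr0n.
rewrite add0r (eq_bigr (fun i => rnorm (x i) ^+ 2)); last by move=> i /negbTE->.
rewrite -big_filter.
have /sqsum_leP/(_ (s ++ [seq i <- t | i \notin s])) :
  (sqsum x <= (fine (sqsum x))%:E)%E by rewrite sqsum_fineK.
rewrite big_cat /= cat_uniq us filter_uniq// andbT => /(_ _)/wrap[].
  apply/hasPn => i; rewrite mem_filter => /andP[]//.
move: xs; lra.
Qed.

(** Truncate to finitely many positions, then approximate each remaining entry
    inside the slice of [P] at its position. Stated for an arbitrary additive
    [P] so as to serve both for the linear span of the basis vectors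
    [single j (f i)] and for a countable set of finitely supported vectors. *)
Lemma dense_ell2 (P : ell2 K -> Prop) : P 0 ->
  (forall x y, P x -> P y -> P (x + y)) ->
  (forall j (y : K) (e : R), 0 < e -> exists2 z, P (single j z) & rnorm (z - y) < e) ->
  forall x (e : R), 0 < e -> exists2 z, P z & rnorm (z - x) < e.
Proof.
move=> P0 PD Pd x e e0.
have [s us xs] := ell2_trunc x (divr_gt0 e0 (ltr0Sn R 1)).
have [z Pz zs] : exists2 z, P z & rnorm (z - \sum_(j <- s) single j (x j)) < e / 2.
  elim: s {us xs} (e / 2) (divr_gt0 e0 (ltr0Sn R 1)) => [|j s IH] d d0.
    by exists 0 => //; rewrite big_nil subrr rnorm0.
  have d2 : 0 < d / 2 by rewrite divr_gt0.
  have [z Pz zs] := IH _ d2; have [w Pw wx] := Pd j (x j) _ d2.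
  exists (single j w + z); first exact: PD.
  rewrite big_cons opprD addrACA -linearB/=.
  apply: le_lt_trans (ler_rnormD _ _) _; rewrite rnorm_single; lra.
exists z => //; move: (\sum_(j <- s) _) xs zs => w xw zw.
rewrite -[z](subrK w) -addrA; apply: le_lt_trans (ler_rnormD _ _) _.
by rewrite rnorm_distC in xw; lra.
Qed.

End Ell2Geometry.

Section Completeness.
Context {R : realType} {K : completeNormedModType R[i]}.

(** Coordinatewise limits exist since [K] is complete. Each finite partial sum
    of squares of [z - x k] is the limit in [m] of those of [x m - x k], so it
    inherits the bound [rho k ^+ 2] (Fatou for finite sums); this gives both
    the membership of [z] in the space and the estimate. *)
Lemma ell2_complete (x : nat -> ell2 K) (rho : nat -> R) :
  (forall k m, (k <= m)%N -> rnorm (x m - x k) <= rho k) ->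
  rho @ \oo --> (0 : R) ->
  exists z, forall k, rnorm (z - x k) <= rho k.
Proof.
move=> xrho rho0.
have rho_ge0 k : 0 <= rho k by apply: le_trans (rnorm_ge0 _) (xrho k k _).
have coord_cvg j : exists l : K, (fun n => x n j) @ \oo --> l.
  suff /cvg_ex[l xl] : cvg ((fun n => x n j) @ \oo) by exists l.
  apply/cauchy_cvgP/cauchy_exP => e /complex_posP[d d0 ->].
  have [k _ kd] : \forall k \near \oo, rho k < d.
    by apply: cvgr_lt (rho0) _ d0.
  exists (x k j); exists k => // m /= km; rewrite -ball_normE /= -rnormE ltcR.
  rewrite rnorm_distC -ell2B; apply: le_lt_trans (rnorm_coord_le _ _) _.
  by apply: le_lt_trans (xrho _ _ km) (kd k _) => /=.
have [z xz] := choice coord_cvg.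
have tail k (s : seq int) : uniq s ->
    \sum_(i <- s) rnorm (z i - x k i) ^+ 2 <= rho k ^+ 2.
  move=> us.
  pose u n := \sum_(i <- s) rnorm (x n i - x k i) ^+ 2.
  have uz : u @ \oo --> \sum_(i <- s) rnorm (z i - x k i) ^+ 2.
    rewrite /u; elim: s {us u} => [|i s IH].
      by under eq_fun do rewrite big_nil; rewrite big_nil; exact: cvg_cst.
    under eq_fun do rewrite big_cons; rewrite big_cons; apply: cvgD => //.
    rewrite expr2; under eq_fun do rewrite expr2.
    suff zi : (fun n => rnorm (x n i - x k i)) @ \oo --> rnorm (z i - x k i).
      exact: cvgM.
    apply/cvgrPdist_lt => e e0.
    have /cvg_rnormP/(_ _ e0) := xz i; apply: filterS => n xn.
    apply: le_lt_trans xn; rewrite ler_norml; apply/andP; split.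
      have -> : x n i - x k i = (x n i - z i) + (z i - x k i).
        by rewrite addrA subrK.
      by have := ler_rnormD (x n i - z i) (z i - x k i); lra.
    have -> : z i - x k i = (z i - x n i) + (x n i - x k i).
      by rewrite addrA subrK.
    by have := ler_rnormD (z i - x n i) (x n i - x k i); rewrite (rnorm_distC (z i) (x n i)); lra.
  apply: (cvgr_to_le uz).
  exists k => // n /= kn.
  by have /rnorm_ell2_leP -> := xrho _ _ kn.
have z_fin : (z : int -> K) \in @ell2_pred R K.
  have zx0 : (fun i => z i - x 0%N i) \in @ell2_pred R K.
    by rewrite inE (@le_lt_trans _ _ (rho 0%N ^+ 2)%:E) ?ltry//; apply/sqsum_leP/tail.
  have -> : z = (Ell2 zx0 + x 0%N : ell2 K) :> (int -> K).
    by apply/funext => i; rewrite ell2D /= subrK.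
  by case: (Ell2 zx0 + x 0%N).
by exists (Ell2 z_fin) => k; apply/rnorm_ell2_leP => // s us; exact: tail.
Qed.

(** Baire category theorem: nested balls with radii at least halved at each step.
    The hypothesis packages density together with openness, by asking that every
    point be approximated by the centre of a ball contained in [G k]. *)
Lemma ell2_baire (G : nat -> set (ell2 K)) :
  (forall k x (e : R), 0 < e -> exists y, exists2 d : R, 0 < d &
     rnorm (y - x) < e /\ forall z, rnorm (z - y) <= d -> G k z) ->
  forall x (e : R), 0 < e -> exists2 z, rnorm (z - x) < e & forall k, G k z.
Proof.
move=> Gd x0 e0 e0_gt0.
have step (kb : nat * (ell2 K * {posnum R})) : exists b : ell2 K * {posnum R},
    [/\ rnorm (b.1 - kb.2.1) <= kb.2.2%:num / 2, b.2%:num <= kb.2.2%:num / 2 &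
        forall z, rnorm (z - b.1) <= b.2%:num -> G kb.1 z].
  case: kb => k [x r] /=.
  have [|y [d d0 [yx yG]]] := Gd k x (r%:num / 2); first by rewrite divr_gt0.
  have rd : 0 < Num.min d (r%:num / 2) by rewrite lt_min d0 divr_gt0.
  exists (y, PosNum rd); split => /=; [exact: ltW|by rewrite ge_min lexx orbT|].
  by move=> z zy; apply: yG; apply: le_trans zy _; rewrite ge_min lexx.
have [g gP] := choice step.
have e2_gt0 : 0 < e0 / 2 by rewrite divr_gt0.
pose b := fix b n := if n is p.+1 then g (p, b p) else (x0, PosNum e2_gt0).
pose x n := (b n).1; pose r n := (b n).2%:num.
have b_step n : [/\ rnorm (x n.+1 - x n) <= r n / 2, r n.+1 <= r n / 2 &
    forall z, rnorm (z - x n.+1) <= r n.+1 -> G n z] := gP (n, b n).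
have r_gt0 n : 0 < r n by rewrite /r.
(* Telescoping: a step moves by at most r/2, which the radius also loses. *)
have x_dist k m : (k <= m)%N -> rnorm (x m - x k) <= r k - r m.
  move=> /subnK <-; elim: (m - k)%N => [|p IH]; first by rewrite !subrr rnorm0.
  rewrite addSn -[x _.+1](subrK (x (p + k)%N)) -addrA.
  apply: le_trans (ler_rnormD _ _) _.
  by have [] := b_step (p + k)%N; lra.
have r_cvg : r @ \oo --> (0 : R).
  have r_geo n : r n <= geometric (e0 / 2) (2^-1) n.
    elim: n => [|n IH]; first by rewrite /geometric /= expr0 mulr1.
    by have [_ + _] := b_step n; move: IH; rewrite /geometric /= exprSr; lra.
  apply: (@squeeze_cvgr _ _ _ _ (fun=> 0) (geometric (e0 / 2) 2^-1)).
  - by apply: nearW => n; rewrite ltW//=.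
  - exact: cvg_cst.
  - by apply: cvg_geometric; rewrite ger0_norm ?invr_ge0// invf_lt1// ltr1n.
have [z zx] : exists z, forall k, rnorm (z - x k) <= r k.
  apply: ell2_complete r_cvg => k m km; apply: le_trans (x_dist _ _ km) _.
  by rewrite gerBl ltW.
exists z => [|k]; last by have [_ _] := b_step k; apply; exact: zx.
by apply: le_lt_trans (zx 0%N) _; rewrite /r /= ltr_pdivrMr// ltr_pMr// ltr1n.
Qed.

End Completeness.

(** * Diagonal operators and weighted shifts *)

Section WeightProducts.
Context {R : realType}.
Implicit Types w : int -> nat -> R.

Definition wprod w (i : nat) (a : int) (n : nat) : R :=
  \prod_(0 <= m < n) w (a + m%:Z) i.

Lemma wprod_gt0 w i a n : (forall v k, 0 < w v k) -> 0 < wprod w i a n.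
Proof. by move=> w0; apply: prodr_gt0 => m _; exact: w0. Qed.

Lemma wprod0 w i a : wprod w i a 0 = 1.
Proof. by rewrite /wprod big_geq. Qed.

Lemma wprodSr w i a n : wprod w i a n.+1 = wprod w i a n * w (a + n%:Z) i.
Proof. by rewrite /wprod big_nat_recr. Qed.

End WeightProducts.

Section DiagonalOperators.
Local Open Scope complex_scope.
Context {R : realType} {K : normedModType R[i]}.
Variable f : nat -> K.

Definition diagonal_weights (A : int -> {linear K -> K}) (w : int -> nat -> R) :=
  forall v k, 0 < w v k /\ A v (f k) = (w v k)%:C *: f k.

(** Allowing a scalar in front of [y] lets the result be iterated, which is
    needed for the products of inverses applied to products of weights. *)
Lemma opprod_eigen (B : int -> K -> K) (y : K) (b : int -> R) :
  (forall v c, B v (c *: y) = (c * (b v)%:C) *: y) ->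
  forall (a : int) n c, opprod a (a + n%:Z - 1) B (c *: y) =
    (c * (\prod_(0 <= m < n) b (a + m%:Z))%:C) *: y.
Proof.
move=> By a n c.
have compE s : (\big[(fun g h => g \o h)/idfun]_(v <- s) B v) (c *: y) =
    (c * (\prod_(v <- s) b v)%:C) *: y.
  elim: s => [|v s IH]; first by rewrite !big_nil mulr1.
  by rewrite !big_cons /= IH By -mulrA -rmorphM [_ * b v]mulrC.
have -> : opprod a (a + n%:Z - 1) B =
    \big[(fun g h => g \o h)/idfun]_(v <- [seq a + m%:Z | m <- iota 0 n]) B v.
  rewrite /opprod /int_range; congr (\big[_/_]_(v <- map _ (iota 0 _)) _); lia.
by rewrite compE big_map /index_iota subn0.
Qed.

Lemma opinv_eigen (A : {linear K -> K}) (y : K) (a : R) : bijective A ->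
  0 < a -> A y = a%:C *: y -> forall c, opinv A (c *: y) = (c * (a^-1)%:C) *: y.
Proof.
move=> bA a0 Ay c.
rewrite -[RHS](opinvK bA) linearZ /= Ay scalerA -mulrA -rmorphM mulVf ?gt_eqF//.
by rewrite rmorph1 mulr1.
Qed.

Section Products.
Variables (A : int -> {linear K -> K}) (w : int -> nat -> R).
Hypotheses (Abij : forall v, bijective (A v)) (Aw : diagonal_weights A w).
Hypothesis f1 : forall i, rnorm (f i) = 1.

Lemma opprod_diag (j : int) n i c :
  opprod j (j + n%:Z - 1) (fun v => A v) (c *: f i) =
  (c * (wprod w i j n)%:C) *: f i.
Proof.
apply: (@opprod_eigen (fun v => A v) _ (w ^~ i)) => v d.
by rewrite linearZ /= (Aw v i).2 scalerA.
Qed.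

Lemma opprod_opinv_diag (j : int) n i c :
  opprod (j - n%:Z) (j - 1) (fun v => opinv (A v)) (c *: f i) =
  (c * ((wprod w i (j - n%:Z) n)^-1)%:C) *: f i.
Proof.
have -> : j - 1 = (j - n%:Z) + n%:Z - 1 by lia.
rewrite (@opprod_eigen (fun v => opinv (A v)) _ (fun v => (w v i)^-1)).
  by rewrite -prodfV.
by move=> v d; have [w0 Awi] := Aw v i; exact: opinv_eigen.
Qed.

Lemma rnorm_diag (c : R) i : 0 <= c -> rnorm (c%:C *: f i) = c.
Proof. by move=> c0; rewrite rnormZr// f1 mulr1. Qed.

Let wp_ge0 i a n : 0 <= wprod w i a n.
Proof. by apply/ltW/wprod_gt0 => v k; have [] := Aw v k. Qed.

Lemma rnorm_opprod (j : int) n i :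
  rnorm (opprod j (j + n%:Z - 1) (fun v => A v) (f i)) = wprod w i j n.
Proof. by rewrite -[f i]scale1r opprod_diag mul1r rnorm_diag. Qed.

Lemma rnorm_opprod_opinv (j : int) n i :
  rnorm (opprod (j - n%:Z) (j - 1) (fun v => opinv (A v)) (f i)) =
  (wprod w i (j - n%:Z) n)^-1.
Proof.
by rewrite -[f i]scale1r opprod_opinv_diag mul1r rnorm_diag ?invr_ge0.
Qed.

End Products.

(** The upper bound [b] is a variable because the products mixing two shifts are
    written with end points that are equal to this one only after arithmetic. *)
Lemma rnorm_opprod_mixed (A A' : int -> {linear K -> K}) (w w' : int -> nat -> R)
    (j b : int) n n' i :
  (forall v, bijective (A v)) -> diagonal_weights A w -> diagonal_weights A' w' ->
  (forall k, rnorm (f k) = 1) -> b = j - n%:Z + n'%:Z - 1 ->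
  rnorm (opprod (j - n%:Z) (j - 1) (fun v => opinv (A v))
          (opprod (j - n%:Z) b (fun v => A' v) (f i))) =
  (wprod w i (j - n%:Z) n)^-1 * wprod w' i (j - n%:Z) n'.
Proof.
move=> Abij Aw A'w f1 ->; rewrite -[f i]scale1r (opprod_diag A'w) mul1r.
rewrite (opprod_opinv_diag Abij Aw) -rmorphM rnorm_diag//; first by rewrite mulrC.
rewrite divr_ge0//; apply/ltW/wprod_gt0 => v k.
  by have [] := A'w v k.
by have [] := Aw v k.
Qed.

End DiagonalOperators.

Section Shifts.
Local Open Scope complex_scope.
Context {R : realType} {K : normedModType R[i]}.
Variables (f : nat -> K) (A : int -> {linear K -> K}) (w : int -> nat -> R).
Variable T : {linear ell2 K -> ell2 K}.
Hypothesis Aw : diagonal_weights f A w.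
Hypothesis TA : forall (x : ell2 K) (j : int), T x j = A (j - 1) (x (j - 1)).

Lemma shift_single (j : int) (y : K) : T (single j y) = single (j + 1) (A j y).
Proof.
apply: eq_ell2 => i; rewrite TA !singleE.
have -> : (i - 1 == j) = (i == j + 1) by apply/eqP/eqP; lia.
by case: eqP => [->|_]; rewrite ?addrK// linear0.
Qed.

Lemma iter_shift_single n (j : int) i :
  iter n T (single j (f i)) = (wprod w i j n)%:C *: single (j + n%:Z) (f i).
Proof.
elim: n => [|n IH]; first by rewrite wprod0 addr0 scale1r.
rewrite iterS IH linearZ /= shift_single (Aw _ _).2 linearZ /= scalerA -rmorphM.
by rewrite -wprodSr; congr (_ *: single _ _); lia.
Qed.

End Shifts.

Section Coefficients.
Local Open Scope complex_scope.
Context {R : realType} {K : normedModType R[i]}.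
Variables (ip : {dot K for @Num.conj R[i]}) (f : nat -> K).
Hypotheses (hip : induces_norm ip) (hf : orthonormal_basis ip f).

Lemma rnorm_basis i : rnorm (f i) = 1.
Proof.
apply/eqP; rewrite -(@eqrXn2 _ 2)// ?rnorm_ge0// expr1n; apply/eqP.
apply: (@complexI R); rewrite rmorphXn /= rnormE hip.
by have [-> _] := hf; rewrite eqxx.
Qed.

(** The codomain is the regular module [R[i]^o], so that [rnorm] is the real
    modulus of a coefficient. *)
Definition fourier (x : K) (i : nat) : R[i]^o := ip x (f i).

(** Bessel for one vector: expand [0 <= ip z z] at the component [z] of [x]
    orthogonal to [f i]. *)
Lemma fourier_le x i : rnorm (fourier x i) <= rnorm x.
Proof.
rewrite -lecR !rnormE -(@ler_pXn2r _ 2) ?nnegrE// hip.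
have := dnorm_ge0 ip (x - fourier x i *: f i).
rewrite dnormB dnormZ /= linearZr_LR /= (hf.1 i i) eqxx mulr1.
have -> : Num.conj (fourier x i) * ip x (f i) = `|fourier x i| ^+ 2.
  by rewrite normCK mulrC.
have -> : Num.conj (`|fourier x i| ^+ 2) = `|fourier x i| ^+ 2.
  by apply: CrealP; rewrite rpredX// normr_real.
by rewrite opprD addrA addrK subr_ge0.
Qed.

Lemma fourierD x y i : fourier (x + y) i = fourier x i + fourier y i.
Proof. exact: linearDl. Qed.

Lemma fourierB x y i : fourier (x - y) i = fourier x i - fourier y i.
Proof. exact: linearBl. Qed.

Lemma fourierZ a x i : fourier (a *: x) i = a *: fourier x i.
Proof. by rewrite /fourier linearZl_LR. Qed.

Lemma fourier_sum (I : Type) (s : seq I) (F : I -> K) i :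
  fourier (\sum_(k <- s) F k) i = \sum_(k <- s) fourier (F k) i.
Proof.
elim/big_rec2: _ => [|k a b _ <-]; last by rewrite fourierD.
by rewrite /fourier linear0l.
Qed.

Lemma fourier_basis k i : fourier (f k) i = (k == i)%:R.
Proof. by rewrite /fourier hf.1. Qed.

(** On partial sums of the expansion of [x] the identity is a computation; it
    passes to the limit because [A] and the coefficient are continuous. *)
Lemma fourier_diag (A : {linear K -> K}) (a : nat -> R) : continuous A ->
  (forall k, A (f k) = (a k)%:C *: f k) ->
  forall x i, fourier (A x) i = (a i)%:C *: fourier x i.
Proof.
move=> cA Af x i; apply/eqP; rewrite -subr_eq0; apply/eqP/rnorm0_eq0.
apply/eqP; rewrite eq_le rnorm_ge0 andbT; apply/ler_addgt0Pr => e e0.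
rewrite add0r.
have [d d0 Ad] := continuous_rnormP cA x e0.
have /cvg_rnormP/(_ _ d0)[n0 _ n0P] := hf.2 x.
pose n := maxn n0 i.+1.
have /Ad : rnorm (series (fun k => ip x (f k) *: f k) n - x) < d.
  by apply: n0P; rewrite /= leq_maxl.
move=> /ltW; apply: le_trans.
set S := series _ n.
have SE : fourier (A S) i = (a i)%:C *: fourier x i.
  rewrite /S /series /= linear_sum /= fourier_sum.
  under eq_bigr => k _ do
    rewrite linearZ /= Af scalerA fourierZ fourier_basis.
  rewrite (bigD1_seq i)/= ?iota_uniq ?mem_index_iota ?leq_max ?ltnSn ?orbT//.
  rewrite eqxx big1 => [|k /negbTE ->]; last by rewrite scaler0.
  by rewrite addr0 [ip _ _ * _]mulrC -scalerA; congr (_ *: _); exact: mulr1.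
by rewrite -SE -fourierB (le_trans (fourier_le _ _))// rnorm_distC.
Qed.

Section ShiftCoefficients.
Variables (A : int -> {linear K -> K}) (w : int -> nat -> R).
Variable T : {linear ell2 K -> ell2 K}.
Hypotheses (Aw : diagonal_weights f A w) (cA : forall v, continuous (A v)).
Hypothesis TA : forall (x : ell2 K) (j : int), T x j = A (j - 1) (x (j - 1)).

Lemma fourier_iter_shift n (x : ell2 K) (j : int) i :
  fourier (iter n T x j) i =
  (wprod w i (j - n%:Z) n)%:C *: fourier (x (j - n%:Z)) i.
Proof.
elim: n j => [|n IH] j; first by rewrite wprod0 subr0 scale1r.
rewrite iterS TA (fourier_diag (a := w (j - 1)) (@cA (j - 1))).
  rewrite IH scalerA -rmorphM mulrC.
  have -> : j - n.+1%:Z = j - 1 - n%:Z by lia.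
  by rewrite wprodSr subrK.
by move=> k; have [] := Aw (j - 1) k.
Qed.

End ShiftCoefficients.

End Coefficients.

(** * A disjoint supercyclicity criterion *)

Section NullSequences.
Context {R : realType}.
Implicit Types u v : nat -> R.

Lemma null_le u v : (forall k, 0 <= u k <= v k) ->
  v @ \oo --> (0 : R) -> u @ \oo --> (0 : R).
Proof.
move=> uv v0; apply: (squeeze_cvgr _ (cvg_cst 0) v0).
by apply: nearW => k; exact: uv.
Qed.

Lemma null_add u v : u @ \oo --> (0 : R) -> v @ \oo --> (0 : R) ->
  (fun k => u k + v k) @ \oo --> (0 : R).
Proof. by move=> u0 v0; rewrite -[X in _ --> X](addr0 (0 : R)); exact: cvgD. Qed.

Lemma null_scale (a : R) u : u @ \oo --> (0 : R) ->
  (fun k => a * u k) @ \oo --> (0 : R).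
Proof. by move=> u0; rewrite -[X in _ --> X](mulr0 a); exact: cvgMr. Qed.

Lemma null_sum (I : finType) (P : pred I) (u : I -> nat -> R) :
  (forall i, P i -> u i @ \oo --> (0 : R)) ->
  (fun k => \sum_(i | P i) u i k) @ \oo --> (0 : R).
Proof.
move=> u0; rewrite [X in _ --> X](_ : 0 = \sum_(i | P i) (0 : R)).
  by apply: cvg_big => //; exact: add_continuous.
by rewrite big1.
Qed.

Lemma harmonic_null (u : nat -> R) k0 : (forall k, 0 <= u k) ->
  (forall k, (k0 <= k)%N -> u k <= k.+1%:R^-1) -> u @ \oo --> (0 : R).
Proof.
move=> u0 uk; apply: (squeeze_cvgr _ (cvg_cst 0) (@cvg_harmonic R)).
by exists k0 => // k /= k0k; rewrite u0 uk.
Qed.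

(** The scalar [c] makes [a / c] and [c * b] small together; a bound on the
    product [a * b] is exactly what such a [c] requires. This is where the
    freedom of the scalars in supercyclicity enters. *)
Lemma exists_scale (a b d : R) : 0 <= a -> 0 <= b -> 0 < d -> a * b <= d ^+ 2 ->
  exists2 c : R, 0 < c & a <= d * c /\ c * b <= d.
Proof.
move=> a0 b0 d0 ab; have [bE|bN0] := eqVneq b 0.
  exists ((a + 1) / d); first by rewrite divr_gt0// ltr_wpDl.
  rewrite bE mulr0 mulrCA divff ?gt_eqF// mulr1; split; last exact: ltW.
  by rewrite lerDl.
have b_gt0 : 0 < b by rewrite lt_neqAle eq_sym bN0.
exists (d / b); first exact: divr_gt0.
by rewrite divfK// mulrA -expr2 ler_pdivlMr.
Qed.

End NullSequences.

Section Criterion.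
Local Open Scope complex_scope.
Context {R : realType} {X : normedModType R[i]} {N : nat}.
Variables (E : X -> Prop) (U : nat -> 'I_N -> {linear X -> X}).

(** Density of the linear span of [E], in the form of an induction principle:
    any linear property true on [E] holds for vectors arbitrarily close to
    every vector. *)
Definition spans_dense := forall P : X -> Prop, P 0 ->
  (forall x y, P x -> P y -> P (x + y)) -> (forall a x, P x -> P (a *: x)) ->
  (forall b, E b -> P b) ->
  forall x (e : R), 0 < e -> exists2 z, P z & rnorm (z - x) < e.

(** The preimages [s k] need not tend to [0]: only their product with the size
    of the forward orbits of [E] does, and a scalar will rebalance the two. *)
Definition vanishing_preimages (l : 'I_N) (y : X) := exists s : nat -> X,
  [/\ forall k, U k l (s k) = y,
      forall t, t != l -> (fun k => rnorm (U k t (s k))) @ \oo --> (0 : R) &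
      forall b t, E b ->
        (fun k => rnorm (s k) * rnorm (U k t b)) @ \oo --> (0 : R)].

Hypothesis Edense : spans_dense.
Hypothesis Epre : forall l b, E b -> vanishing_preimages l b.

(** Having vanishing preimages is a linear property of the vector. *)
Lemma vanishing_preimages_dense l x (e : R) : 0 < e ->
  exists2 y, vanishing_preimages l y & rnorm (y - x) < e.
Proof.
apply: Edense => [|y y' [s [sy s0 sE]] [s' [sy' s0' sE']]|a y [s [sy s0 sE]]|b].
- exists (fun=> 0); split=> [k|t _|b t _]; first exact: linear0.
    by under eq_fun do rewrite linear0 rnorm0; exact: cvg_cst.
  by under eq_fun do rewrite rnorm0 mul0r; exact: cvg_cst.
- exists (fun k => s k + s' k); split=> [k|t tl|b t Eb].
  + by rewrite linearD sy sy'.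
  + apply: null_le (null_add (s0 t tl) (s0' t tl)) => k /=.
    by rewrite rnorm_ge0 linearD ler_rnormD.
  + apply: null_le (null_add (sE b t Eb) (sE' b t Eb)) => k /=.
    by rewrite mulr_ge0 ?rnorm_ge0//= -mulrDl ler_wpM2r ?rnorm_ge0 ?ler_rnormD.
- exists (fun k => a *: s k); split=> [k|t tl|b t Eb].
  + by rewrite linearZ /= sy.
  + under eq_fun do rewrite linearZ rnormZ.
    by apply: null_scale; exact: s0.
  + under eq_fun do rewrite rnormZ -mulrA.
    by apply: null_scale; exact: sE.
- exact: Epre.
Qed.

(** The sequences [s j] are fixed first, as the size condition is then linear
    in [y]. *)
Lemma vanishing_products_dense (I : Type) (s : I -> nat -> X) :
  (forall j b t, E b ->
    (fun k => rnorm (s j k) * rnorm (U k t b)) @ \oo --> (0 : R)) ->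
  forall x (e : R), 0 < e -> exists2 y,
    forall j t, (fun k => rnorm (s j k) * rnorm (U k t y)) @ \oo --> (0 : R) &
    rnorm (y - x) < e.
Proof.
move=> sE; apply: Edense => [j t|y y' sy sy' j t|a y sy j t|b Eb j t].
- by under eq_fun do rewrite linear0 rnorm0 mulr0; exact: cvg_cst.
- apply: null_le (null_add (sy j t) (sy' j t)) => k /=.
  by rewrite mulr_ge0 ?rnorm_ge0//= -mulrDr linearD ler_wpM2l ?rnorm_ge0 ?ler_rnormD.
- under eq_fun do rewrite linearZ rnormZ mulrCA.
  by apply: null_scale; exact: sy.
- exact: sE.
Qed.

(** Disjoint supercyclicity criterion. Replace [x] by some [y0] whose orbits
    balance the preimages, and [Y t] by some [y] having preimages [s t k]; then
    [y0 + c^-1 *: \sum_l s l k] is the required vector. Indeed [c *: U k t] sends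
    it to the sum of [c *: U k t y0] (small), of the image [y] of [s t k], and of
    the cross terms [U k t (s l k)], [l != t] (small), where [c] comes from
    [exists_scale]. *)
Lemma supercyclic_approximation (x : X) (Y : 'I_N -> X) (e : R) : 0 < e ->
  exists k (c : R[i]) u, rnorm (u - x) < e /\
    forall t, rnorm (c *: U k t u - Y t) < e.
Proof.
move=> e0; have e2 : 0 < e / 2 by rewrite divr_gt0.
have e4 : 0 < e / 4 by rewrite divr_gt0.
have /choice[s sP] : forall l, exists s : nat -> X,
   [/\ exists2 y, (forall k, U k l (s k) = y) & rnorm (y - Y l) < e / 2,
      forall t, t != l -> (fun k => rnorm (U k t (s k))) @ \oo --> (0 : R) &
      forall b t, E b ->
        (fun k => rnorm (s k) * rnorm (U k t b)) @ \oo --> (0 : R)].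
  move=> l; have [y [s [sy s0 sE]] yY] := vanishing_preimages_dense l (Y l) e2.
  by exists s; split=> //; exists y.
have [y0 sy0 y0x] : exists2 y, forall l t,
    (fun k => rnorm (s l k) * rnorm (U k t y)) @ \oo --> (0 : R) &
    rnorm (y - x) < e / 2.
  by apply: vanishing_products_dense => // l b t Eb; have [_ _] := sP l; apply.
pose a k := \sum_l rnorm (s l k); pose b k := \sum_t rnorm (U k t y0).
pose d k := \sum_t \sum_(l | l != t) rnorm (U k t (s l k)).
have ab0 : (fun k => a k * b k) @ \oo --> (0 : R).
  have -> : (fun k => a k * b k) =
      (fun k => \sum_l \sum_t rnorm (s l k) * rnorm (U k t y0)).
    by apply/funext => k; rewrite /a /b big_distrlr.
  by apply: null_sum => l _; apply: null_sum => t _; exact: sy0.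
have d0 : d @ \oo --> (0 : R).
  apply: null_sum => t _; apply: null_sum => l lt.
  by have [_ + _] := sP l; apply; rewrite eq_sym.
have [k [abk dk]] : exists k, a k * b k < (e / 4) ^+ 2 /\ d k < e / 4.
  have : \forall k \near \oo, a k * b k < (e / 4) ^+ 2 /\ d k < e / 4.
    near=> k; split; near: k; first by apply: cvgr_lt ab0 _ _; rewrite exprn_gt0.
    exact: cvgr_lt d0 _ _.
  by case=> k _ kP; exists k; apply: kP => /=.
have sum_ge0 (P : pred 'I_N) (F : 'I_N -> X) : 0 <= \sum_(l | P l) rnorm (F l).
  by apply: sumr_ge0 => l _; exact: rnorm_ge0.
have [c c0 [ac cb]] := exists_scale (sum_ge0 _ _) (sum_ge0 _ _) e4 (ltW abk).
exists k, c%:C, (y0 + (c^-1)%:C *: \sum_l s l k); split.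
  rewrite addrAC; apply: le_lt_trans (ler_rnormD _ _) _.
  rewrite rnormZr ?invr_ge0 ?(ltW c0)//.
  have : c^-1 * rnorm (\sum_l s l k) <= e / 4.
    rewrite mulrC ler_pdivrMr//; apply: le_trans (rnorm_sum _ _ _) ac.
  by move: y0x e0; lra.
move=> t; have [[y syt yY] _ _] := sP t.
rewrite linearD linearZ linear_sum /= scalerDr scalerA -rmorphM mulfV ?gt_eqF//.
rewrite rmorph1 scale1r (bigD1 t)//= syt addrCA addrAC.
apply: le_lt_trans (ler_rnormD _ _) _.
have ct : c * rnorm (U k t y0) <= e / 4.
  apply: le_trans cb; rewrite ler_wpM2l ?(ltW c0)// /b (bigD1 t)//= lerDl.
  exact: sum_ge0.
have dt : rnorm (\sum_(l | l != t) U k t (s l k)) < e / 4.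
  apply: le_lt_trans (rnorm_sum _ _ _) (le_lt_trans _ dk).
  by rewrite /d [leRHS](bigD1 t)//= lerDl sumr_ge0.
have := ler_rnormD (c%:C *: U k t y0) (\sum_(l | l != t) U k t (s l k)).
rewrite rnormZr ?(ltW c0)//.
by move: yY ct dt e0; lra.
Unshelve. all: by end_near. Qed.

End Criterion.

(** * Sufficiency of the weight conditions *)

Section IterLinear.
Context {R : realType} {X : normedModType R[i]}.
Implicit Types T : {linear X -> X}.

Lemma iter_is_linear n T : linear (iter n T).
Proof. by move=> a x y; elim: n => // n IH; rewrite !iterS IH linearP. Qed.

HB.instance Definition _ n T :=
  GRing.isLinear.Build R[i] X X *:%R (iter n T) (iter_is_linear n T).

Lemma iter_continuous n T : continuous T -> continuous (iter n T).
Proof.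
move=> cT; elim: n => [|n IH] x; first exact: cvg_id.
exact: (continuous_comp (IH x) (cT _)).
Qed.

Lemma approximation_open (N : nat) (U : 'I_N -> {linear X -> X}) (c : R[i]) u
    (Y : 'I_N -> X) (e : R) :
  (forall t, continuous (U t)) -> (forall t, rnorm (c *: U t u - Y t) < e) ->
  exists2 d : R, 0 < d &
    forall z, rnorm (z - u) <= d -> forall t, rnorm (c *: U t z - Y t) < e.
Proof.
move=> cU uY.
have : nbhs u [set z | forall t, rnorm (c *: U t z - Y t) < e].
  apply: (@filter_forall _ _ (fun t z => rnorm (c *: U t z - Y t) < e) _
    (nbhs_filter u)) => t.
  apply/nbhs_rnormP.
  have cg : continuous (fun z => c *: U t z).
    by move=> z; apply: cvgZ; [exact: cvg_cst|exact: cU].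
  have [|d d0 gd] := continuous_rnormP cg u (e := e - rnorm (c *: U t u - Y t)).
    by rewrite subr_gt0.
  exists d => // z /gd zu /=; rewrite -[c *: U t z](subrK (c *: U t u)) -addrA.
  by apply: le_lt_trans (ler_rnormD _ _) _; rewrite -ltrBrDr.
move=> /nbhs_rnormP[d d0 dP]; exists (d / 2); first by rewrite divr_gt0.
by move=> z zu; apply: dP; apply: le_lt_trans zu _; rewrite ltr_pdivrMr// ltr_pMr// ltr1n.
Qed.

End IterLinear.

Section DenseOrbits.
Context {R : realType} {K : completeNormedModType R[i]}.

(** Targets and precisions are coded by one countable type, so that approximating
    every tuple becomes a sequence of conditions. *)
Lemma dense_sequence_tuples {X : normedModType R[i]} (D : nat -> X) N :
  (forall x (e : R), 0 < e -> exists k, rnorm (D k - x) < e) ->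
  exists (Y : nat -> 'I_N -> X) (eps : nat -> R), (forall k, 0 < eps k) /\
    forall (Z : 'I_N -> X) (e : R), 0 < e ->
      exists2 k, eps k < e & forall t, rnorm (Y k t - Z t) < e.
Proof.
move=> Dd.
pose code k : {ffun 'I_N -> nat} * nat := odflt ([ffun=> 0%N], 0%N) (unpickle k).
exists (fun k t => D ((code k).1 t)), (fun k => (code k).2.+1%:R^-1).
split=> [k|Z e e0]; first by rewrite invr_gt0.
have /choice[g gP] t : exists k, rnorm (D k - Z t) < e by exact: Dd.
have [m] := ltr_add_invr e0; rewrite add0r => me.
exists (pickle ([ffun t => g t], m)); rewrite /code pickleK //= => t.
by rewrite ffunE.
Qed.

(** By Baire, it suffices to satisfy countably many open conditions: one for each
    target tuple and precision of [dense_sequence_tuples]. *)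
Lemma dense_common_orbits (N : nat) (U : nat -> 'I_N -> {linear ell2 K -> ell2 K})
    (D : nat -> ell2 K) :
  (forall x (e : R), 0 < e -> exists k, rnorm (D k - x) < e) ->
  (forall k t, continuous (U k t)) ->
  (forall x (Y : 'I_N -> ell2 K) (e : R), 0 < e ->
    exists k (c : R[i]) u, rnorm (u - x) < e /\
      forall t, rnorm (c *: U k t u - Y t) < e) ->
  forall x (e : R), 0 < e -> exists2 z, rnorm (z - x) < e &
    forall (Y : 'I_N -> ell2 K) (d : R), 0 < d ->
      exists k (c : R[i]), forall t, rnorm (c *: U k t z - Y t) < d.
Proof.
move=> Dd cU approx x e e0.
have [Y [eps [eps0 Yd]]] := dense_sequence_tuples N Dd.
pose G m := [set z | exists k (c : R[i]),
  forall t, rnorm (c *: U k t z - Y m t) < eps m].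
have [|z zx zG] := @ell2_baire _ _ G _ x e e0.
  move=> m y d d0; have dm : 0 < Num.min d (eps m) by rewrite lt_min d0 eps0.
  have [k [c [u [uy uY]]]] := approx y (Y m) _ dm.
  have {}uY t : rnorm (c *: U k t u - Y m t) < eps m.
    by apply: lt_le_trans (uY t) _; rewrite ge_min lexx orbT.
  have [d' d'0 d'P] := approximation_open (cU k) uY.
  exists u, d' => //; split.
    by apply: lt_le_trans uy _; rewrite ge_min lexx.
  by move=> z /d'P zY; exists k, c.
exists z => // Z d d0; have d2 : 0 < d / 2 by rewrite divr_gt0.
have [m md YZ] := Yd Z _ d2; have [k [c zY]] := zG m.
exists k, c => t; have zYt := lt_trans (zY t) md.
rewrite -[_ *: _](subrK (Y m t)) -addrA.
by apply: le_lt_trans (ler_rnormD _ _) _; have := YZ t; lra.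
Qed.

Lemma ell2_separable : @separable R K ->
  exists D : nat -> ell2 K,
    forall x (e : R), 0 < e -> exists k, rnorm (D k - x) < e.
Proof.
move=> [S /pcard_surjP[g gS] dS].
pose vec (s : seq (int * nat)) : ell2 K := \sum_(b <- s) single b.1 (g b.2).
exists (fun k => vec (odflt [::] (unpickle k))) => x e e0.
have [|||_ [s ->] sx] := @dense_ell2 _ _ (fun z => exists s, z = vec s) _ _ _ x e e0.
- by exists [::]; rewrite /vec big_nil.
- by move=> _ _ [s ->] [t ->]; exists (s ++ t); rewrite /vec big_cat.
- move=> j y d d0; have /dense_rnormP/(_ y d d0)[z Sz zy] := dS.
  have [k _ gk] := gS z Sz.
  by exists (g k); [exists [:: (j, k)]; rewrite /vec big_seq1|rewrite gk].
by exists (pickle s); rewrite pickleK.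
Qed.

Lemma ell2_span_dense (ip : {dot K for @Num.conj R[i]}) (f : nat -> K) :
  orthonormal_basis ip f ->
  spans_dense (fun b : ell2 K => exists j i, b = single j (f i)).
Proof.
move=> hf P P0 PD PZ Pf; apply: dense_ell2 => // j y e e0.
have /cvg_rnormP/(_ _ e0)[n _ /(_ n (leqnn n)) yn] := hf.2 y.
exists (series (fun k => ip y (f k) *: f k) n) => //.
rewrite /series /= linear_sum; elim/big_ind: _ => // k _.
by rewrite linearZ; apply/PZ/Pf; exists j, k.
Qed.

End DenseOrbits.

Section Sufficiency.
Local Open Scope complex_scope.
Context {R : realType} {K : completeNormedModType R[i]}.
Variables (ip : {dot K for @Num.conj R[i]}) (f : nat -> K) (N : nat).
Variables (A : 'I_N -> int -> {linear K -> K}) (w : 'I_N -> int -> nat -> R).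
Variables (T : 'I_N -> {linear ell2 K -> ell2 K}) (r : 'I_N -> nat).
Variable n : nat -> nat.
Hypotheses (hip : induces_norm ip) (hsep : @separable R K).
Hypothesis hf : orthonormal_basis ip f.
Hypotheses (Aw : forall l, diagonal_weights f (A l) (w l)).
Hypothesis hT : forall l, is_forward_shift (A l) (T l).

Hypothesis products_vanish : forall i1 i2 (j1 j2 : int) l s,
  (fun k => (wprod (w l) i1 (j1 - (r l * n k)%:Z) (r l * n k))^-1 *
            wprod (w s) i2 j2 (r s * n k)) @ \oo --> (0 : R).
Hypothesis quotients_vanish : forall i (j : int) s l, s != l ->
  (fun k => (wprod (w s) i (j - (r s * n k)%:Z) (r s * n k))^-1 *
            wprod (w l) i (j - (r s * n k)%:Z) (r l * n k)) @ \oo --> (0 : R).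

Let U k l : {linear ell2 K -> ell2 K} := iter (r l * n k) (T l).

Let w_gt0 l v i : 0 < w l v i. Proof. by have [] := Aw l v i. Qed.

(** On the basis vector at position [j], a right inverse of the [n]-fold shift
    goes back [n] positions and divides by the product of the weights crossed. *)
Lemma shift_vanishing_preimages l b :
  (exists j i, b = single j (f i)) ->
  vanishing_preimages (fun b => exists j i, b = single j (f i)) U l b.
Proof.
move=> [j [i ->]].
pose p k := wprod (w l) i (j - (r l * n k)%:Z) (r l * n k).
have p0 k : 0 < p k by apply: wprod_gt0 => v m; exact: w_gt0.
have rnormU k t j' i' : rnorm (U k t (single j' (f i'))) =
    wprod (w t) i' j' (r t * n k).
  rewrite /U /= (iter_shift_single (Aw t) (hT t).2) rnormZr.
    by rewrite rnorm_single (rnorm_basis hip hf) mulr1.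
  by apply/ltW/wprod_gt0 => v m; exact: w_gt0.
exists (fun k => ((p k)^-1)%:C *: single (j - (r l * n k)%:Z) (f i)); split.
- move=> k; rewrite linearZ /U /= (iter_shift_single (Aw l) (hT l).2).
  by rewrite scalerA -rmorphM mulVf ?gt_eqF// rmorph1 scale1r subrK.
- move=> t tl; under eq_fun do rewrite linearZ /= rnormZr ?invr_ge0 ?ltW// rnormU.
  by apply: quotients_vanish; rewrite eq_sym.
- move=> _ t [j' [i' ->]].
  under eq_fun do rewrite rnormU rnormZr ?invr_ge0 ?ltW// rnorm_single
    (rnorm_basis hip hf) mulr1.
  exact: products_vanish.
Qed.

Lemma shifts_densely_d_supercyclic :
  densely_d_supercyclic (fun l => iter (r l) (T l)).
Proof.
have iterU k l x : iter (n k) (iter (r l) (T l)) x = U k l x.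
  by rewrite -iterM mulnC.
have [D Dd] := ell2_separable hsep.
have vectors_dense x (e : R) : 0 < e -> exists2 z, rnorm (z - x) < e &
    d_supercyclic_vector (fun l => iter (r l) (T l)) z.
  move=> e0.
  have [k l|x' Y d d0|z zx zY] := @dense_common_orbits _ _ N U D Dd _ _ x e e0.
  - by apply: iter_continuous; exact: (hT l).1.
  - apply: (supercyclic_approximation _ _ _ _ d0); first exact: ell2_span_dense hf.
    exact: shift_vanishing_preimages.
  exists z => //; apply/dense_prodP => Y d d0; have [k [c zk]] := zY Y d d0.
  exists (fun l => c *: iter (n k) (iter (r l) (T l)) z); first by exists (n k), c.
  by move=> l; rewrite iterU.
split=> [l|].
  have [z _ zd] := vectors_dense 0 1 ltr01; exists z.
  apply/dense_rnormP => y e e0; have /dense_prodP/(_ (fun=> y) _ e0) := zd.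
  by case=> _ [m [c ->]] /(_ l) zy; exists (c *: iter m (iter (r l) (T l)) z) => //; exists m, c.
by apply/dense_rnormP => x e e0; have [z zx zd] := vectors_dense x e e0; exists z.
Qed.

End Sufficiency.

(** * Necessity of the weight conditions *)

Section Windows.

Definition window (m : nat) : seq (int * nat) :=
  [seq (j, i) | j <- int_range (- m%:Z) m%:Z, i <- iota 0 m.+1].

Lemma mem_window m j i :
  ((j, i) \in window m) = (- m%:Z <= j <= m%:Z) && (i <= m)%N.
Proof.
rewrite /window; apply/allpairsP/idP => [[[j' i'] [+ + [-> ->]]]|/andP[jm im]].
  by rewrite mem_int_range mem_iota => ->.
by exists (j, i); split; rewrite ?mem_int_range ?mem_iota.
Qed.

Lemma uniq_window m : uniq (window m).
Proof.
apply: allpairs_uniq => [||[a b] [c d] _ _ [-> ->]//]; last exact: iota_uniq.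
by rewrite map_inj_uniq ?iota_uniq// => a b /addrI [].
Qed.

Context {R : realType} {K : normedModType R[i]}.
Variables (ip : {dot K for @Num.conj R[i]}) (f : nat -> K).
Hypothesis hf : orthonormal_basis ip f.

Definition window_vector m : ell2 K := \sum_(b <- window m) single b.1 (f b.2).

Lemma fourier_window m j i :
  fourier ip f (window_vector m j) i = ((j, i) \in window m)%:R.
Proof.
rewrite /window_vector ell2_sum fourier_sum.
have coef b : fourier ip f (single b.1 (f b.2) j) i = (b == (j, i))%:R.
  case: b => j' i'; rewrite singleE xpair_eqE eq_sym /=.
  case: eqP => _ /=; first exact: fourier_basis hf _ _.
  by rewrite /fourier linear0l.
rewrite (eq_bigr _ (fun b _ => coef b)).
have [jm|jm] := boolP ((j, i) \in window m).
  rewrite (bigD1_seq (j, i)) ?uniq_window//= eqxx big1 ?addr0// => b.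
  by move=> /negbTE ->.
rewrite big_seq big1// => b bm.
by case: eqP => // bE; rewrite -bE bm in jm.
Qed.

End Windows.

Section RealEstimates.
Context {R : realType}.

Lemma exists_common_bound (q : nat -> R) (e : R) M : 0 < e ->
  (forall k, 0 < q k) ->
  exists2 d : R, 0 < d <= e & forall k, (k <= M)%N -> d <= q k.
Proof.
move=> e0 q0; elim: M => [|M [d /andP[d0 de] dq]].
  exists (Num.min e (q 0%N)); first by rewrite lt_min e0 q0 ge_min lexx.
  by move=> k; rewrite leqn0 => /eqP ->; rewrite ge_min lexx orbT.
exists (Num.min d (q M.+1)); first by rewrite lt_min d0 q0 ge_min de.
move=> k; rewrite leq_eqVlt ltnS => /orP[/eqP ->|/dq dk].
  by rewrite ge_min lexx orbT.
by rewrite ge_min dk.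
Qed.

(** The arithmetic of the necessity direction. Here [X j i] is the modulus of the
    coefficient of a vector close to the indicator of a window, and the
    quantities [wprod _ * (C * X _)] are the moduli of the coefficients of its
    scaled images, close to the indicator of the next window. As [n] exceeds the
    widths, a shift by [r l * n], or by the difference of two such lengths,
    carries a position of the window outside both windows. So
    each weight product, or ratio of two, can be compared with one coefficient
    that is large and one that is at most [d]. *)
Lemma window_estimates (N : nat) (w : 'I_N -> int -> nat -> R)
    (r : 'I_N -> nat) (X : int -> nat -> R) (C d : R) (m n : nat) :
  (forall l v k, 0 < w l v k) ->
  (forall l, (0 < r l)%N) -> (forall s l, s != l -> r s != r l) ->
  0 <= C -> (forall j i, 0 <= X j i) -> 0 < d -> (2 * m + 2 <= n)%N ->
  (forall j i, (j, i) \in window m -> 2^-1 <= X j i) ->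
  (forall j i, (j, i) \notin window m -> X j i <= d) ->
  (forall l j i, (j, i) \in window m.+1 -> 2^-1 <=
    wprod (w l) i (j - (r l * n)%:Z) (r l * n) * (C * X (j - (r l * n)%:Z) i)) ->
  (forall l j i, (j, i) \notin window m.+1 ->
    wprod (w l) i (j - (r l * n)%:Z) (r l * n) * (C * X (j - (r l * n)%:Z) i) <= d) ->
  (forall b1 b2 l s, b1 \in window m -> b2 \in window m ->
    (wprod (w l) b1.2 (b1.1 - (r l * n)%:Z) (r l * n))^-1 *
    wprod (w s) b2.2 b2.1 (r s * n) <= 4 * d ^+ 2) /\
  (forall b s l, b \in window m -> s != l ->
    (wprod (w s) b.2 (b.1 - (r s * n)%:Z) (r s * n))^-1 *
    wprod (w l) b.2 (b.1 - (r s * n)%:Z) (r l * n) <= 2 * d).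
Proof.
move=> w0 r0 rN C0 X0 d0 mn Xin Xout Yin Yout; split.
  move=> [j1 i1] [j2 i2] l s b1 b2 /=.
  have b1' : (j1, i1) \in window m.+1 by move: b1; rewrite !mem_window; lia.
  have rl : (n <= r l * n)%N by rewrite leq_pmull.
  have rs : (n <= r s * n)%N by rewrite leq_pmull.
  have := Yin l _ _ b1'.
  have := Xout (j1 - (r l * n)%:Z) i1.
  have /(_ _)/wrap[|] := Yout s (j2 + (r s * n)%:Z) i2.
    by move: b2; rewrite !mem_window; lia.
  rewrite addrK.
  have := Xin _ _ b2; have := X0 (j1 - (r l * n)%:Z) i1.
  have := wprod_gt0 i1 (j1 - (r l * n)%:Z) (r l * n) (w0 l).
  have := wprod_gt0 i2 j2 (r s * n) (w0 s).
  move: (wprod (w l) i1 _ _) (wprod (w s) i2 _ _) (X (_ - _) _) (X j2 _).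
  move=> P1 P2 X1 X2.
  move=> P2_gt0 P1_gt0 X1_ge0 X2_ge Y2 /(_ _)/wrap[|X1d Y1].
    by move: b1; rewrite !mem_window; lia.
  have P2C : P2 * C <= 2 * d.
    have : P2 * C * 2^-1 <= d.
      apply: le_trans Y2; rewrite mulrA ler_wpM2l// mulr_ge0// ltW//.
    lra.
  have P1C : 1 <= 2 * (P1 * C * d).
    have : 2^-1 <= P1 * C * d.
      apply: le_trans Y1 _; rewrite mulrA ler_wpM2l// mulr_ge0// ltW//.
    lra.
  rewrite mulrC ler_pdivrMr//.
  have P1d : 0 <= P1 * d by rewrite mulr_ge0// ltW.
  apply: le_trans (_ : P2 * (2 * (P1 * C * d)) <= _).
    by rewrite -{1}[P2]mulr1 ler_wpM2l// ltW.
  have := ler_wpM2l P1d P2C; rewrite expr2; nra.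
(* The two products start from the same position, so the unknown coefficient
   there cancels in their ratio. *)
move=> [j i] s l b sl /=.
have b' : (j, i) \in window m.+1 by move: b; rewrite !mem_window; lia.
have := Yin s _ _ b'.
have /(_ _)/wrap[|] := Yout l (j - (r s * n)%:Z + (r l * n)%:Z) i.
  move: b; rewrite !mem_window.
  have := rN _ _ sl; rewrite neq_ltn => /orP[] rsl.
    have : (r s * n + n <= r l * n)%N by rewrite addnC -mulSn leq_mul2r rsl orbT.
    lia.
  have : (r l * n + n <= r s * n)%N by rewrite addnC -mulSn leq_mul2r rsl orbT.
  lia.
rewrite addrK.
have := wprod_gt0 i (j - (r s * n)%:Z) (r s * n) (w0 s).
have := wprod_gt0 i (j - (r s * n)%:Z) (r l * n) (w0 l).
have := mulr_ge0 C0 (X0 (j - (r s * n)%:Z) i).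
move: (wprod (w s) _ _ _) (wprod (w l) _ _ _) (C * _) => P1 P2 q q0 P2_gt0 P1_gt0 P2q P1q.
rewrite mulrC ler_pdivrMr//.
have q_gt0 : 0 < q.
  by rewrite lt_neqAle q0 andbT; apply/eqP => qE; move: P1q; rewrite -qE mulr0; lra.
rewrite -(ler_pM2r q_gt0); apply: le_trans P2q _.
have := ler_wpM2l (ltW d0) P1q; nra.
Qed.

End RealEstimates.

Section Necessity.
Local Open Scope complex_scope.
Context {R : realType} {K : normedModType R[i]}.
Variables (ip : {dot K for @Num.conj R[i]}) (f : nat -> K) (N : nat).
Variables (A : 'I_N -> int -> {linear K -> K}) (w : 'I_N -> int -> nat -> R).
Variables (T : 'I_N -> {linear ell2 K -> ell2 K}) (r : 'I_N -> nat).
Hypotheses (hip : induces_norm ip).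
Hypotheses (hf : orthonormal_basis ip f) (N0 : (0 < N)%N).
Hypotheses (Aw : forall l, diagonal_weights f (A l) (w l)).
Hypothesis cA : forall l v, continuous (A l v).
Hypothesis hT : forall l, is_forward_shift (A l) (T l).
Hypothesis r0 : forall l, (0 < r l)%N.
Hypothesis rN : forall s l, s != l -> r s != r l.
Hypothesis dense_d : densely_d_supercyclic (fun l => iter (r l) (T l)).

Definition small_window (e : R) (m n : nat) :=
  (forall b1 b2 l s, b1 \in window m -> b2 \in window m ->
    (wprod (w l) b1.2 (b1.1 - (r l * n)%:Z) (r l * n))^-1 *
    wprod (w s) b2.2 b2.1 (r s * n) <= e) /\
  (forall b s l, b \in window m -> s != l ->
    (wprod (w s) b.2 (b.1 - (r s * n)%:Z) (r s * n))^-1 *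
    wprod (w l) b.2 (b.1 - (r s * n)%:Z) (r l * n) <= e).

Let w_gt0 l v i : 0 < w l v i. Proof. by have [] := Aw l v i. Qed.

Let fourier_close (x y : ell2 K) (d : R) j i : rnorm (x - y) < d ->
  rnorm (fourier ip f (x j) i - fourier ip f (y j) i) <= d.
Proof.
move=> xy; rewrite -fourierB; apply: le_trans (fourier_le hip hf _ _) _.
by rewrite -ell2B; apply: le_trans (rnorm_coord_le _ _) (ltW xy).
Qed.

(** The uniform bound [2] only serves to bound the scalar in
    [exists_small_window]. *)
Let rnorm_near_indicator (a : R[i]^o) (b : bool) (d : R) : d <= 2^-1 ->
  rnorm (a - b%:R) <= d ->
  [/\ rnorm a <= 2, b -> 2^-1 <= rnorm a & ~~ b -> rnorm a <= d].
Proof.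
move=> d2 ab; have n1 : rnorm (1 : R[i]^o) = 1 by rewrite /rnorm normr1.
have [h1 h2] : rnorm a <= d + rnorm (b%:R : R[i]^o) /\
    rnorm (b%:R : R[i]^o) <= d + rnorm a.
  split; first by rewrite -{1}[a](subrK b%:R) (le_trans (ler_rnormD _ _))// lerD2r.
  rewrite -{1}[b%:R](subrK a) (le_trans (ler_rnormD _ _))// lerD2r.
  by rewrite rnorm_distC.
by case: b ab h1 h2 => _; rewrite ?n1 ?rnorm0 => h1 h2; split=> //; lra.
Qed.

(** Approximate the window vector of size [m] by a disjoint supercyclic vector
    [x], and let its orbit approximate the same window vector of size [m.+1] in
    all coordinates. To keep the exponent [n] away from the finitely many values
    [n <= M], the target window is larger: its coefficient at position [- m.+1]
    is produced from a coefficient of [x] left of the first window, hence of size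
    at most [d], which forces a scalar of order [1 / d]; but the coefficient
    of [x] at position [0] is near [1] and is sent to a coefficient of modulus at most
    [2], which bounds the scalar independently of [d]. *)
Lemma exists_small_window (m M : nat) (e : R) : 0 < e ->
  exists2 n, (M < n)%N & small_window e m n.
Proof.
move=> e0; pose l0 := Ordinal N0; pose M' := (M + 2 * m + 2)%N.
pose P n := wprod (w l0) 0 (- m.+1%:Z - (r l0 * n)%:Z) (r l0 * n).
pose P' n := wprod (w l0) 0 0 (r l0 * n).
have P0 n : 0 < P n by apply: wprod_gt0; exact: w_gt0.
have P'0 n : 0 < P' n by apply: wprod_gt0; exact: w_gt0.
(* For n <= M' the two bounds on the scalar give P' n <= 8 * P n * d; the
   factor 16 in the choice of d contradicts this. *)
have [|k|d /andP[d0 de] dP] :=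
    @exists_common_bound R (fun n => P' n / (16 * P n)) (Num.min (e / 4) 2^-1) M'.
- by rewrite lt_min invr_gt0 ltr0n divr_gt0.
- by rewrite divr_gt0// mulr_gt0.
move: de; rewrite le_min => /andP[de d2].
have /dense_rnormP/(_ (window_vector f m) d d0)[x /dense_prodP xd xm] := dense_d.2.
have [_ [n [c ->]] xn] := xd (fun=> window_vector f m.+1) d d0.
pose X j i := rnorm (fourier ip f (x j) i); pose C := complex.Re `|c|.
have C0 : 0 <= C by rewrite -lecR RRe_real ?normr_real ?normr_ge0.
have X0 j i : 0 <= X j i by exact: rnorm_ge0.
have XP j i := rnorm_near_indicator d2 (eq_ind _ (fun z => rnorm (_ - z) <= d)
  (fourier_close j i xm) _ (fourier_window hf m j i)).
have YP l j i : [/\ wprod (w l) i (j - (r l * n)%:Z) (r l * n) * (C * X (j - (r l * n)%:Z) i) <= 2,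
    (j, i) \in window m.+1 -> 2^-1 <=
      wprod (w l) i (j - (r l * n)%:Z) (r l * n) * (C * X (j - (r l * n)%:Z) i) &
    (j, i) \notin window m.+1 ->
      wprod (w l) i (j - (r l * n)%:Z) (r l * n) * (C * X (j - (r l * n)%:Z) i) <= d].
  have := rnorm_near_indicator d2 (eq_ind _ (fun z => rnorm (_ - z) <= d)
    (fourier_close j i (xn l)) _ (fourier_window hf m.+1 j i)).
  rewrite -iterM mulnC ell2Z fourierZ rnormZ.
  rewrite (fourier_iter_shift hip hf (Aw l) (@cA l) (hT l).2) rnormZr; last first.
    by apply/ltW/wprod_gt0; exact: w_gt0.
  by rewrite mulrCA.
have nM : (M' < n)%N.
  rewrite ltnNge; apply/negP => /dP.
  rewrite ler_pdivlMr ?mulr_gt0// => dPn.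
  have [_ _ X1] := XP (- m.+1%:Z - (r l0 * n)%:Z) 0%N.
  have {}X1 := X1 ltac:(rewrite mem_window; lia).
  have [_ Y1 _] := YP l0 (- m.+1%:Z) 0%N.
  have {}Y1 := Y1 ltac:(rewrite mem_window; lia).
  have [_ X2 _] := XP 0 0%N.
  have {}X2 := X2 ltac:(rewrite mem_window; lia).
  have [Y2 _ _] := YP l0 (r l0 * n)%:Z 0%N.
  rewrite subrr -/(P' n) in Y2; rewrite -/(P n) in Y1.
  have PCd : 2^-1 <= P n * C * d.
    apply: le_trans Y1 _; rewrite mulrA ler_wpM2l// mulr_ge0// ltW//.
  have PC' : P' n * C * 2^-1 <= 2.
    by apply: le_trans Y2; rewrite mulrA ler_wpM2l// mulr_ge0// ltW.
  have h1 := ler_wpM2l (ltW (P'0 n)) PCd.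
  have Pd : 0 <= P n * d by rewrite mulr_ge0// ltW.
  have h2 := ler_wpM2l Pd PC'.
  have := P'0 n; nra.
exists n; first by apply: leq_ltn_trans nM; rewrite /M' -addnA leq_addr.
have [|j i|j i|l j i|l j i|h1 h2] :=
  @window_estimates R N w r X C d m n w_gt0 r0 rN C0 X0 d0.
- by move: nM; rewrite /M'; lia.
- by have [_ + _] := XP j i.
- by have [_ _] := XP j i.
- by have [_ + _] := YP l j i.
- by have [_ _] := YP l j i.
have d2e : 2 * d <= e by lra.
split=> [b1 b2 l s hb1 hb2|b s l hb sl]; last exact: le_trans (h2 _ _ _ hb sl) _.
apply: le_trans (h1 _ _ _ _ hb1 hb2) _; apply: le_trans d2e.
by rewrite expr2; have := ler_wpM2l (ltW d0) d2; lra.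
Qed.

(** The [k]-th term is small with precision [1 / k.+1] on the window of size [k],
    and every choice of indices lies in all but finitely many windows. *)
Lemma exists_vanishing_sequence : exists n : nat -> nat,
  [/\ forall k, (0 < n k)%N,
      forall k m, (k < m)%N -> (n k < n m)%N,
      forall i1 i2 (j1 j2 : int) l s,
        (fun k => (wprod (w l) i1 (j1 - (r l * n k)%:Z) (r l * n k))^-1 *
            wprod (w s) i2 j2 (r s * n k)) @ \oo --> (0 : R) &
      forall i (j : int) s l, s != l ->
        (fun k => (wprod (w s) i (j - (r s * n k)%:Z) (r s * n k))^-1 *
            wprod (w l) i (j - (r s * n k)%:Z) (r l * n k)) @ \oo --> (0 : R)].
Proof.
have /choice[g gP] (mM : nat * nat) : exists n, (mM.2 < n)%N /\
    small_window mM.1.+1%:R^-1 mM.1 n.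
  have e0 : 0 < mM.1.+1%:R^-1 :> R by rewrite invr_gt0.
  by have [n] := exists_small_window mM.1 mM.2 e0; exists n.
pose n := fix n k := if k is k'.+1 then g (k, n k') else g (0%N, 0%N).
have n_small k : small_window k.+1%:R^-1 k (n k).
  by case: k => [|k]; [exact: (gP (0%N, 0%N)).2|exact: (gP (k.+1, n k)).2].
have n_step k : (n k < n k.+1)%N := (gP (k.+1, n k)).1.
have wp_ge0 l i a p : 0 <= wprod (w l) i a p by apply/ltW/wprod_gt0; exact: w_gt0.
exists n; split.
- by case=> [|k]; [exact: (gP (0%N, 0%N)).1|exact: leq_ltn_trans (n_step k)].
- by move=> k m; apply: (@homo_ltn _ n (fun a b => (a < b)%N)) => // a b c; exact: ltn_trans.
- move=> i1 i2 j1 j2 l s.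
  apply: (@harmonic_null _ _ (maxn (maxn i1 i2) (maxn `|j1|%N `|j2|%N))) => k.
    by rewrite mulr_ge0 ?invr_ge0.
  move=> kk; apply: ((n_small k).1 (j1, i1) (j2, i2)); rewrite mem_window; lia.
- move=> i j s l sl; apply: (@harmonic_null _ _ (maxn i `|j|%N)) => k.
    by rewrite mulr_ge0 ?invr_ge0.
  by move=> kk; apply: ((n_small k).2 (j, i)) => //; rewrite mem_window; lia.
Qed.

End Necessity.

(** * The equivalence *)

Theorem theorem4p1 (R : realType) (K : completeNormedModType R[i])
  (ip : {dot K for @Num.conj R[i]}) (f : nat -> K)
  (N : nat) (A : 'I_N -> int -> {linear K -> K})
  (T : 'I_N -> {linear ell2 K -> ell2 K}) (r : 'I_N -> nat)
  (hip : induces_norm ip) (hsep : @separable R K)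
  (hf : orthonormal_basis ip f) (hN : (2 <= N)%N)
  (hA : forall l n, pos_inv_diagonal f (A l n))
  (hAb : forall l, uniformly_bounded (A l))
  (hT : forall l, is_forward_shift (A l) (T l))
  (hr0 : forall l, (1 <= r l)%N)
  (hr : forall s l : 'I_N, (s < l)%N -> (r s < r l)%N) :
  densely_d_supercyclic (fun l => iter (r l) (T l)) <->
  exists n : nat -> nat,
    [/\ forall k, (0 < n k)%N,
        forall k m, (k < m)%N -> (n k < n m)%N,
        forall (i1 i2 : nat) (j1 j2 : int) (l s : 'I_N),
          (fun k =>
             rnorm (opprod (j1 - (r l * n k)%N%:Z) (j1 - 1)
                      (fun v => opinv (A l v)) (f i1)) *
             rnorm (opprod j2 (j2 + (r s * n k)%N%:Z - 1)
                      (fun v => A s v) (f i2)))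
          @ \oo --> (0 : R) &
        forall (i : nat) (j : int) (s l : 'I_N), (s < l)%N ->
          (fun k =>
             rnorm (opprod (j - (r s * n k)%N%:Z) (j - 1)
                      (fun v => opinv (A s v))
                      (opprod (j - (r s * n k)%N%:Z)
                         (j + ((r l - r s) * n k)%N%:Z - 1)
                         (fun v => A l v) (f i))))
          @ \oo --> (0 : R) /\
          (fun k =>
             rnorm (opprod (j - (r l * n k)%N%:Z) (j - 1)
                      (fun v => opinv (A l v))
                      (opprod (j - (r l * n k)%N%:Z)
                         (j - ((r l - r s) * n k)%N%:Z - 1)
                         (fun v => A s v) (f i))))
          @ \oo --> (0 : R)].
Proof.
have f1 := rnorm_basis hip hf.
have Abij l v : bijective (A l v) by have [] := hA l v.
have cA l v : continuous (A l v) by have [] := hA l v.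
have /choice[a aP] (lv : 'I_N * int) : exists a : nat -> R,
    forall k, 0 < a k /\ A lv.1 lv.2 (f k) = (a k)%:C%C *: f k.
  by have [] := hA lv.1 lv.2.
pose w l v := a (l, v).
have Aw l : diagonal_weights f (A l) (w l) by move=> v; exact: (aP (l, v)).
have productE i1 i2 (j1 j2 : int) l s m :
    rnorm (opprod (j1 - (r l * m)%N%:Z) (j1 - 1) (fun v => opinv (A l v)) (f i1)) *
    rnorm (opprod j2 (j2 + (r s * m)%N%:Z - 1) (fun v => A s v) (f i2)) =
    (wprod (w l) i1 (j1 - (r l * m)%N%:Z) (r l * m))^-1 *
    wprod (w s) i2 j2 (r s * m).
  by rewrite (rnorm_opprod_opinv (Abij l) (Aw l) f1) (rnorm_opprod (Aw s) f1).
(* For s < l the two limits on the left are the instances (s, l) and (l, s) of a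
   single quotient of weight products. *)
have quotientE i (j : int) (s l : 'I_N) m : (s < l)%N ->
    rnorm (opprod (j - (r s * m)%N%:Z) (j - 1) (fun v => opinv (A s v))
      (opprod (j - (r s * m)%N%:Z) (j + ((r l - r s) * m)%N%:Z - 1)
        (fun v => A l v) (f i))) =
    (wprod (w s) i (j - (r s * m)%N%:Z) (r s * m))^-1 *
      wprod (w l) i (j - (r s * m)%N%:Z) (r l * m) /\
    rnorm (opprod (j - (r l * m)%N%:Z) (j - 1) (fun v => opinv (A l v))
      (opprod (j - (r l * m)%N%:Z) (j - ((r l - r s) * m)%N%:Z - 1)
        (fun v => A s v) (f i))) =
    (wprod (w l) i (j - (r l * m)%N%:Z) (r l * m))^-1 *
      wprod (w s) i (j - (r l * m)%N%:Z) (r s * m).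
  move=> /hr rsl; have rslm : (r s * m <= r l * m)%N by rewrite leq_mul2r ltnW ?orbT.
  by split; apply: rnorm_opprod_mixed => //; rewrite mulnBl; lia.
have rN (s l : 'I_N) : s != l -> r s != r l.
  by rewrite -val_eqE neq_ltn neq_ltn => /orP[/hr->//|/hr->]; rewrite orbT.
have N0 : (0 < N)%N by exact: ltnW.
split=> [/(exists_vanishing_sequence hip hf N0 Aw cA hT hr0 rN)|].
  move=> [n [n0 n_incr products quotients]]; exists n; split=> //.
    by move=> i1 i2 j1 j2 l s; under eq_fun do rewrite productE; exact: products.
  move=> i j s l sl.
  have sNl : s != l by rewrite -val_eqE neq_ltn sl.
  split; [under eq_fun do rewrite (quotientE _ _ _ _ _ sl).1
         |under eq_fun do rewrite (quotientE _ _ _ _ _ sl).2].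
    exact: quotients.
  by apply: quotients; rewrite eq_sym.
move=> [n [_ _ products quotients]].
apply: (@shifts_densely_d_supercyclic _ _ ip f N A w T r n) => //.
  move=> i1 i2 j1 j2 l s; have := products i1 i2 j1 j2 l s.
  by under eq_fun do rewrite productE.
move=> i j s l; rewrite -val_eqE neq_ltn => /orP[sl|ls].
  have [+ _] := quotients i j s l sl.
  by under eq_fun do rewrite (quotientE _ _ _ _ _ sl).1.
have [_] := quotients i j l s ls.
by under eq_fun do rewrite (quotientE _ _ _ _ _ ls).2.
Qed.
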